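(* Let $p$ be a prime and $G$ an abelian $p$-group. Then $G$ is semi-generalized Bassian if, and only if, one of the following holds: (1) $G$ is divisible; (2) $G$ has finite $p$-rank (i.e., $G[p]$ is finite); (3) for some positive integer $n$, $G \cong G' \oplus F$, where $G' \cong \big(\bigoplus_I \mathbb{Z}_{p^n}\big) \oplus \big(\bigoplus_J \mathbb{Z}_{p^{n+1}}\big)$ for some index sets $I, J$, and $F$ is a finite subgroup with $F[p] \subseteq (p^{n+1}G)[p]$.
   Context: All groups are additively written abelian groups; $\mathbb{Z}_{p^k}$ is the cyclic group of order $p^k$; for a group $A$, $A[p] = \{a \in A : pa = 0\}$. A subgroup $H$ of a group $A$ is essential in $A$ if $H \cap S \neq \{0\}$ for every non-zero subgroup $S$ of $A$. A group $G$ is semi-generalized Bassian if, for every subgroup $H \le G$, the existence of an injective homomorphism $G \to G/H$ implies that $H$ is an essential subgroup of some direct summand of $G$. *)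

(* Defs.v *)
From HB Require Import structures.
From mathcomp Require Import all_boot all_algebra.
From Stdlib Require List.
Set Implicit Arguments. Unset Strict Implicit. Unset Printing Implicit Defensive.
Import GRing.Theory.
Local Open Scope ring_scope.

Section Defs.
Variable G : zmodType.

Definition subgroup (H : G -> Prop) : Prop :=
  H 0 /\ (forall x y, H x -> H y -> H (x - y)).

Definition nonzero_grp (S : G -> Prop) : Prop := exists s, S s /\ s <> 0.

Definition essential (H A : G -> Prop) : Prop :=
  forall S : G -> Prop, subgroup S -> (forall x, S x -> A x) -> nonzero_grp S ->
    exists s, S s /\ H s /\ s <> 0.

Definition int_direct_sum (A B : G -> Prop) : Prop :=
  subgroup A /\ subgroup B /\ (forall x, A x -> B x -> x = 0) /\
  (forall x, exists a b, A a /\ B b /\ x = a + b).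

Definition direct_summand (D : G -> Prop) : Prop :=
  exists C : G -> Prop, int_direct_sum D C.

(* A homomorphism G -> G/H, presented by a choice of coset representatives
   f x (a function G -> G/H is exactly such a choice, up to H). *)
Definition hom_to_quot (H : G -> Prop) (f : G -> G) : Prop :=
  forall x y, H (f (x + y) - (f x + f y)).

Definition inj_to_quot (H : G -> Prop) (f : G -> G) : Prop :=
  forall x y, H (f x - f y) -> x = y.

Definition semi_generalized_bassian : Prop :=
  forall H : G -> Prop, subgroup H ->
    (exists f : G -> G, hom_to_quot H f /\ inj_to_quot H f) ->
    exists D : G -> Prop, subgroup D /\ direct_summand D /\
      (forall x, H x -> D x) /\ essential H D.

Definition p_group (p : nat) : Prop := forall x : G, exists k, x *+ (p ^ k) = 0.

Definition divisible : Prop := forall (x : G) (n : nat), (0 < n)%N -> exists y, y *+ n = x.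

Definition finite_set (A : G -> Prop) : Prop := exists s : seq G, forall x, A x -> x \in s.

Definition finite_p_rank (p : nat) : Prop := finite_set (fun x => x *+ p = 0).

(* The external direct sum  (+)_{k : K} Z_{m k}, modelled concretely:
   elements are finitely supported c : K -> nat with c k < m k,
   and addition is coordinatewise mod m k. *)
Definition dsum_elem (K : Type) (m : K -> nat) (c : K -> nat) : Prop :=
  (forall k, (c k < m k)%N) /\ exists s : list K, forall k, c k <> 0%N -> List.In k s.

Definition dsum_add (K : Type) (m : K -> nat) (c d : K -> nat) : K -> nat :=
  fun k => ((c k + d k) %% m k)%N.

Definition iso_to_dsum (A : G -> Prop) (K : Type) (m : K -> nat) : Prop :=
  exists Phi : (K -> nat) -> G,
    (forall c, dsum_elem m c -> A (Phi c)) /\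
    (forall c d, dsum_elem m c -> dsum_elem m d -> Phi (dsum_add m c d) = Phi c + Phi d) /\
    (forall c d, dsum_elem m c -> dsum_elem m d -> Phi c = Phi d -> c = d) /\
    (forall a, A a -> exists c, dsum_elem m c /\ Phi c = a).

Definition two_orders (p n : nat) (I J : Type) (k : I + J) : nat :=
  match k with inl _ => (p ^ n)%N | inr _ => (p ^ n.+1)%N end.

Definition condition3 (p : nat) : Prop :=
  exists n : nat, (0 < n)%N /\
    exists (G' F : G -> Prop) (I J : Type),
      int_direct_sum G' F /\
      iso_to_dsum G' (@two_orders p n I J) /\
      finite_set F /\
      (forall y, F y -> y *+ p = 0 -> exists x : G, y = x *+ (p ^ n.+1)).

End Defs.

(* Main.v *)
(* Sufficiency. Inside a divisible group, a maximal essential extension of [H] is divisible, hence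
   a summand. If [G[p]] is finite, counting the elements of [G[p^j]] shows that an embedding
   [G -> G/H] forces [H] into every [p^j G], hence into the divisible part. In case (3) the
   finiteness of [p^(n+1) G] forces [H] to meet it trivially; as [G[p]] lies in [p^(n-1) G], a
   maximal essential extension of [H] in [G] is then pure and bounded, hence a summand.

   Necessity. Choose [x] outside [p G] of minimal order [p^(m+1)]. A subgroup [H] containing some
   [x + p y] with [H[p]] inside [p^(m+1) G] is never essential in a summand, because purity of the
   summand would produce a socle element of height exactly [m]. Such an [H] with [G] embedded in
   [G/H] is found
   - if all the [(p^k G)[p]] are infinite: inside a countable direct sum [M] of cyclic groups, with
     [M/H] divisible of infinite rank; an embedding of [M] in [M/H] extends to [G];
   - if [(p^n G)[p]] is infinite and [(p^(n+1) G)[p]] finite, where either [n >= m + 2] or [G] is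
     not bounded: by shifting a summand that is an infinite sum of copies of [Z(p^(n+1))].
   Otherwise [G] is bounded, [(p^(m+2) G)[p]] is finite, and (3) holds with [G'] maximal subject to
   meeting [p^(m+2) G] trivially. *)
Require Import Defs.
From HB Require Import structures.
From mathcomp Require Import all_boot all_algebra finmap.
From mathcomp Require Import boolp classical_sets cardinality.
From mathcomp Require Import monalg zify.
Set Implicit Arguments. Unset Strict Implicit. Unset Printing Implicit Defensive.
Import GRing.Theory.
Local Open Scope classical_set_scope.
Local Open Scope ring_scope.

(** * Subgroups *)

Section Subgroups.
Variable V : zmodType.
Implicit Types (A C D H Q : set V) (x y : V).

Lemma subgroup0 D : subgroup D -> D 0. Proof. by case. Qed.

Lemma subgroupB D x y : subgroup D -> D x -> D y -> D (x - y).
Proof. by case=> _; apply. Qed.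

Lemma subgroupN D x : subgroup D -> D x -> D (- x).
Proof. by move=> sD Dx; rewrite -sub0r; apply: subgroupB => //; apply: subgroup0. Qed.

Lemma subgroupD D x y : subgroup D -> D x -> D y -> D (x + y).
Proof. by move=> sD Dx Dy; rewrite -(opprK y); apply: subgroupB => //; apply: subgroupN. Qed.

Lemma subgroupMn D x n : subgroup D -> D x -> D (x *+ n).
Proof.
move=> sD Dx; elim: n => [|n IHn]; first by rewrite mulr0n; apply: subgroup0.
by rewrite mulrS; apply: subgroupD.
Qed.

Lemma subgroupMz D x (a : int) : subgroup D -> D x -> D (x *~ a).
Proof.
move=> sD Dx; case: a => n; rewrite ?NegzE ?mulrNz -pmulrn; first exact: subgroupMn.
by apply: subgroupN => //; apply: subgroupMn.
Qed.

Lemma subgroup_sum D (I : Type) (s : seq I) (P : pred I) (F : I -> V) :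
  subgroup D -> (forall i, P i -> D (F i)) -> D (\sum_(i <- s | P i) F i).
Proof. by move=> sD DF; elim/big_ind: _ => // [|u v]; [apply: subgroup0|apply: subgroupD]. Qed.

Lemma subgroupT : subgroup [set: V]. Proof. by []. Qed.

Lemma subgroup_set0 : subgroup [set (0 : V)].
Proof. by split=> // x y -> ->; rewrite subrr. Qed.

Lemma subgroupI A D : subgroup A -> subgroup D -> subgroup (A `&` D).
Proof.
move=> sA sD; split; first by split; apply: subgroup0.
by move=> x y [Ax Dx] [Ay Dy]; split; apply: subgroupB.
Qed.

Lemma mulrzMnC x (a : int) n : x *~ a *+ n = x *+ n *~ a.
Proof. by rewrite !pmulrn -!mulrzA mulrC. Qed.

Lemma mulrz_natM x (n : nat) (a : int) : x *~ (n%:Z * a) = x *+ n *~ a.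
Proof. by rewrite mulrzA pmulrn. Qed.

Lemma mulrz_dvdz x (n : nat) (a : int) : (n%:Z %| a)%Z -> x *~ a = x *+ n *~ (a %/ n%:Z)%Z.
Proof. by move=> na; rewrite -mulrz_natM mulrC divzK. Qed.

Lemma subgroupMz_dvdz D x (n : nat) (a : int) :
  subgroup D -> (n%:Z %| a)%Z -> D (x *+ n) -> D (x *~ a).
Proof. by move=> sD na Dx; rewrite (mulrz_dvdz x na); apply: subgroupMz. Qed.

Lemma mulrz_eq0_dvdz x (n : nat) (a : int) : (n%:Z %| a)%Z -> x *+ n = 0 -> x *~ a = 0.
Proof. exact: (subgroupMz_dvdz subgroup_set0). Qed.

Lemma subgroup_coprimez D x (a b : int) :
  subgroup D -> coprimez a b -> D (x *~ a) -> D (x *~ b) -> D x.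
Proof.
move=> sD /coprimezP[[u v] /= uv] Da Db; rewrite -(mulr1z x) -uv mulrzDr.
by apply: subgroupD; rewrite // mulrC mulrzA; apply: subgroupMz.
Qed.

Definition multiples D n : set V := [set x *+ n | x in D].
Definition torsion D n : set V := [set x | D x /\ x *+ n = 0].
Definition sumset D C : set V := [set x + y | x in D & y in C].

Lemma subgroup_multiples D n : subgroup D -> subgroup (multiples D n).
Proof.
move=> sD; split; first by exists 0; rewrite ?mul0rn //; apply: subgroup0.
by move=> _ _ [x Dx <-] [y Dy <-]; exists (x - y); rewrite ?mulrnBl //; apply: subgroupB.
Qed.

Lemma subgroup_torsion D n : subgroup D -> subgroup (torsion D n).
Proof.
move=> sD; split; first by split; [apply: subgroup0 | rewrite mul0rn].
move=> x y [Dx xn] [Dy yn]; split; first exact: subgroupB.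
by rewrite mulrnBl xn yn subrr.
Qed.

Lemma subgroup_sumset D C : subgroup D -> subgroup C -> subgroup (sumset D C).
Proof.
move=> sD sC; split.
  by exists 0; [apply: subgroup0 | exists 0; [apply: subgroup0 | rewrite addr0]].
move=> _ _ [x Dx [y Cy <-]] [x' Dx' [y' Cy' <-]].
exists (x - x'); first exact: subgroupB.
by exists (y - y'); [apply: subgroupB | rewrite opprD addrACA].
Qed.

Lemma sub_sumsetl D C : subgroup C -> D `<=` sumset D C.
Proof. by move=> sC x Dx; exists x => //; exists 0; rewrite ?addr0 //; apply: subgroup0. Qed.

Lemma sub_sumsetr D C : subgroup D -> C `<=` sumset D C.
Proof. by move=> sD x Cx; exists 0; [apply: subgroup0 | exists x; rewrite ?add0r]. Qed.

Definition adjoin D x : set V := [set d + x *~ a | d in D & a in [set: int]].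

Lemma subgroup_adjoin D x : subgroup D -> subgroup (adjoin D x).
Proof.
move=> sD; split; first by exists 0; [apply: subgroup0 | exists 0; rewrite // mulr0z addr0].
move=> _ _ [d Dd [a _ <-]] [e De [b _ <-]].
by exists (d - e); [apply: subgroupB | exists (a - b); rewrite // mulrzBr opprD addrACA].
Qed.

Lemma sub_adjoin D x : D `<=` adjoin D x.
Proof. by move=> d Dd; exists d => //; exists 0; rewrite // mulr0z addr0. Qed.

Lemma mem_adjoin D x : subgroup D -> adjoin D x x.
Proof. by move=> sD; exists 0; [apply: subgroup0 | exists 1; rewrite // add0r]. Qed.

Definition maximal_in Q D := [/\ subgroup D, D `<=` Q & forall x, adjoin D x `<=` Q -> D x].

Lemma exists_maximal_in Q H : subgroup H -> H `<=` Q -> exists2 D, H `<=` D & maximal_in Q D.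
Proof.
move=> sH HQ; pose between D := [/\ subgroup D, H `<=` D & D `<=` Q].
pose P D := D = set0 \/ between D.
have [F FP totF|D [PD maxD]] := @Zorn_bigcup V P.
  have betweenF X x : F X -> X x -> between X.
    by move=> FX Xx; case: (FP _ FX) => // X0; rewrite X0 in Xx.
  case: (pselect (exists2 X, F X & between X)) => [[X FX bX]|noX]; last first.
    left; apply/seteqP; split=> // x [X FX Xx]; apply: noX.
    by exists X => //; apply: betweenF Xx.
  right; split=> [|x Hx|x [Y FY Yx]]; last by have [_ _] := betweenF _ _ FY Yx; apply.
    split=> [|x y [Y FY Yx] [Z FZ Zy]].
      by exists X => //; case: bX => sX _ _; apply: subgroup0.
    have [YZ|ZY] := totF _ _ FY FZ.
      by exists Z => //; have [sZ _ _] := betweenF _ _ FZ Zy; apply: subgroupB => //; apply: YZ.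
    by exists Y => //; have [sY _ _] := betweenF _ _ FY Yx; apply: subgroupB => //; apply: ZY.
  by exists X => //; case: bX => _ + _; apply.
have [sD HD DQ] : between D.
  case: PD => // D0; case: (maxD H); last by right; split.
  by rewrite D0; split=> // H0; exact: (H0 0 (subgroup0 sH)).
exists D => //; split=> // x Qx; apply: contrapT => nDx; apply: (maxD (adjoin D x)).
  split; first exact: sub_adjoin.
  by move=> sub; apply: nDx; apply: sub; apply: mem_adjoin.
right; split=> //; first exact: subgroup_adjoin.
exact: subset_trans HD (@sub_adjoin D x).
Qed.

End Subgroups.

(** * Integral linear combinations *)

Section LinearCombinations.
Variable K : choiceType.

Lemma malg_divz (n : K -> nat) (q : {malg K}) : (forall k, ((n k)%:Z %| q@_k)%Z) ->
  exists r : {malg K}, forall k, q@_k = (n k)%:Z * r@_k.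
Proof.
move=> nq; exists [malg k in msupp q => (q@_k %/ (n k)%:Z)%Z] => k.
rewrite mcoeffE; case: ifPn => [_|/mcoeff_outdom->]; last by rewrite mulr0.
by rewrite mulrC divzK.
Qed.

Definition supported (X : set K) : set {malg K} := [set q | forall k, ~ X k -> q@_k = 0].

Lemma subgroup_supported X : subgroup (supported X).
Proof.
split=> [k _|q r Xq Xr k nXk]; first by rewrite mcoeff0.
by rewrite mcoeffB Xq // Xr // subrr.
Qed.

Lemma supportedT q : supported setT q. Proof. by move=> k []. Qed.

Lemma supportedU X (c : int) k : X k -> supported X << c *g k >>.
Proof. by move=> Xk l nXl; rewrite mcoeffU; case: eqP => // kl; case: nXl; rewrite -kl. Qed.

Section Combination.
Variables (V : zmodType) (v : K -> V).

Definition lincomb (q : {malg K}) : V := \sum_(k <- msupp q) v k *~ q@_k.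

Lemma lincomb_widen q (s : {fset K}) : (msupp q `<=` s)%fset ->
  lincomb q = \sum_(k <- s) v k *~ q@_k.
Proof.
move=> qs; rewrite /lincomb (big_fset_incl _ qs) // => k _ /mcoeff_outdom ->.
by rewrite mulr0z.
Qed.

Fact lincomb_is_zmod_morphism : zmod_morphism lincomb.
Proof.
move=> q r; pose s := (msupp q `|` msupp r)%fset.
rewrite (@lincomb_widen (q - r) s) ?msuppB_le // (@lincomb_widen q s) ?fsubsetUl //.
rewrite (@lincomb_widen r s) ?fsubsetUr // -sumrB.
by apply: eq_bigr => k _; rewrite mcoeffB mulrzBr.
Qed.

HB.instance Definition _ :=
  GRing.isZmodMorphism.Build {malg K} V lincomb lincomb_is_zmod_morphism.

Lemma lincombU c k : lincomb << c *g k >> = v k *~ c.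
Proof.
rewrite /lincomb msuppU; case: eqP => [->|_]; first by rewrite big_nil mulr0z.
by rewrite big_seq_fset1 mcoeffUU.
Qed.

Lemma lincomb1 k : lincomb << k >> = v k. Proof. exact: lincombU. Qed.

Lemma lincomb_subgroup D q : subgroup D -> (forall k, D (v k *~ q@_k)) -> D (lincomb q).
Proof. by move=> sD Dq; apply: subgroup_sum. Qed.

Lemma lincomb_eq0 q : (forall k, v k *~ q@_k = 0) -> lincomb q = 0.
Proof. exact: (lincomb_subgroup (subgroup_set0 V)). Qed.

Definition zspan X : set V := [set lincomb q | q in supported X].

Lemma subgroup_zspan X : subgroup (zspan X).
Proof.
have sX := subgroup_supported X.
split; first by exists 0; rewrite ?raddf0 //; apply: subgroup0.
by move=> _ _ [q Xq <-] [r Xr <-]; exists (q - r); rewrite ?raddfB //; apply: (subgroupB sX).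
Qed.

Lemma mem_zspan X k : X k -> zspan X (v k).
Proof. by move=> Xk; exists << k >>; [apply: supportedU | rewrite lincomb1]. Qed.

Lemma zspan_sub X D : subgroup D -> (forall k, X k -> D (v k)) -> zspan X `<=` D.
Proof.
move=> sD DX _ [q Xq <-]; apply: lincomb_subgroup => // k.
case: (pselect (X k)) => [/DX Dk|/Xq->]; first exact: subgroupMz.
by rewrite mulr0z; apply: subgroup0.
Qed.

End Combination.

Variable V : zmodType.
Implicit Types (v : K -> V) (q r : {malg K}).

Lemma eq_lincomb v w q r : (forall k, v k *~ q@_k = w k *~ r@_k) -> lincomb v q = lincomb w r.
Proof.
move=> E; rewrite (@lincomb_widen _ v q (msupp q `|` msupp r)%fset) ?fsubsetUl //.
by rewrite (@lincomb_widen _ w r (msupp q `|` msupp r)%fset) ?fsubsetUr //; apply: eq_bigr.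
Qed.

Lemma lincombMn v q n : lincomb v q *+ n = lincomb (fun k => v k *+ n) q.
Proof. by rewrite -sumrMnl; apply: eq_bigr => k _; rewrite mulrzMnC. Qed.

Lemma lincomb_scale v (n : K -> nat) q r : (forall k, q@_k = (n k)%:Z * r@_k) ->
  lincomb v q = lincomb (fun k => v k *+ n k) r.
Proof. by move=> E; apply: eq_lincomb => k; rewrite E mulrzA pmulrn. Qed.

End LinearCombinations.

Lemma raddf_lincomb (K : choiceType) (V W : zmodType) (f : {additive V -> W}) (v : K -> V) q :
  f (lincomb v q) = lincomb (f \o v) q.
Proof. by rewrite raddf_sum; apply: eq_bigr => k _; rewrite raddfMz. Qed.

Lemma lincomb_delta (K : choiceType) k (q : {malg K}) :
  lincomb (fun j => (j == k)%:R : int) q = q@_k.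
Proof.
rewrite [in RHS](monalgE q) raddf_sum; apply: eq_bigr => j _.
by rewrite /= mcoeffU; case: eqP; rewrite ?mul0rz // intz.
Qed.

Definition relabel (K L : choiceType) (f : K -> L) : {malg K} -> {malg L} :=
  lincomb (fun k => << f k >>).

Lemma lincomb_relabel (K L : choiceType) (V : zmodType) (v : L -> V) (f : K -> L) q :
  lincomb v (relabel f q) = lincomb (v \o f) q.
Proof. by rewrite /relabel raddf_lincomb; apply: eq_lincomb => k /=; rewrite lincomb1. Qed.

Lemma mcoeff_relabel (K L : choiceType) (f : K -> L) q k :
  injective f -> (relabel f q)@_(f k) = q@_k.
Proof.
move=> f_inj; rewrite -lincomb_delta lincomb_relabel -[RHS]lincomb_delta.
by apply: eq_lincomb => j /=; rewrite (inj_eq f_inj).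
Qed.

Lemma mcoeff_relabel_eq0 (K L : choiceType) (f : K -> L) q l :
  (forall k, f k <> l) -> (relabel f q)@_l = 0.
Proof.
move=> fl; rewrite -lincomb_delta lincomb_relabel; apply: lincomb_eq0 => k /=.
by case: eqP => [/fl|_] //; rewrite mul0rz.
Qed.

Lemma lincomb_sum_type (I J : choiceType) (q : {malg (I + J)%type}) :
  exists qI qJ, [/\ forall i, qI@_i = q@_(inl i), forall j, qJ@_j = q@_(inr j) &
    forall (V : zmodType) (v : I + J -> V),
      lincomb v q = lincomb (v \o inl) qI + lincomb (v \o inr) qJ].
Proof.
exists (lincomb (fun k => if k is inl i then << i >> else 0) q).
exists (lincomb (fun k => if k is inr j then << j >> else 0) q); split=> [i|j|V v].
- rewrite -2!lincomb_delta raddf_lincomb; apply: eq_lincomb => -[i'|j'] /=.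
    by rewrite lincomb1.
  by rewrite raddf0.
- rewrite -2!lincomb_delta raddf_lincomb; apply: eq_lincomb => -[i'|j'] /=.
    by rewrite raddf0.
  by rewrite lincomb1.
- rewrite !raddf_lincomb -big_split; apply: eq_bigr => -[i|j] _ /=.
    by rewrite lincomb1 raddf0 mul0rz addr0.
  by rewrite lincomb1 raddf0 mul0rz add0r.
Qed.

(** * Elements of prime power order *)

Section PrimePowers.
Variables (p : nat) (V : zmodType).
Hypothesis p_pr : prime p.
Implicit Types (D : set V) (x z : V).

Lemma mulrn_expD x k l : x *+ p ^ k *+ p ^ l = x *+ p ^ (k + l).
Proof. by rewrite expnD mulrnA. Qed.

Lemma mulrn_expSr x k : x *+ p ^ k *+ p = x *+ p ^ k.+1.
Proof. by rewrite expnSr mulrnA. Qed.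

Lemma mulrn_expS x k : x *+ p *+ p ^ k = x *+ p ^ k.+1.
Proof. by rewrite expnS mulrnA. Qed.

Lemma prime_dvdz_of_notin D x (a : int) :
  subgroup D -> D (x *+ p) -> ~ D x -> D (x *~ a) -> (p%:Z %| a)%Z.
Proof.
move=> sD Dpx nDx Dax; apply: contrapT => /negP pa; apply: nDx.
apply: (subgroup_coprimez (a := p%:Z) sD _ _ Dax); last by rewrite -pmulrn.
by rewrite /coprimez /gcdz eqz_nat -/(coprime _ _) prime_coprime.
Qed.

Lemma primeX_dvdz_of_notin D x m (a : int) :
  subgroup D -> D (x *+ p ^ m.+1) -> ~ D (x *+ p ^ m) -> D (x *~ a) -> ((p ^ m.+1)%:Z %| a)%Z.
Proof.
move=> sD Dx nDx Dax.
suff: forall j, (j <= m.+1)%N -> ((p ^ j)%:Z %| a)%Z by apply.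
elim=> [|j IHj] jm; first by rewrite expn0 dvd1z.
have /dvdzP[b aE] := IHj (ltnW jm); rewrite aE expnS PoszM dvdz_mul //.
apply: (prime_dvdz_of_notin (x := x *+ p ^ m) sD) => //; first by rewrite mulrn_expSr.
rewrite -(@subnKC j m jm) -mulrn_expD -mulrzMnC -mulrz_natM [_ * b]mulrC -aE.
exact: subgroupMn.
Qed.

Lemma torsion_cyclic n z : z *+ p ^ n.+1 = 0 -> z *+ p ^ n <> 0 ->
  torsion (adjoin [set 0] z) p `<=` adjoin [set 0] (z *+ p ^ n).
Proof.
move=> zn zn0 _ [[_ -> [a _ <-]]]; rewrite add0r mulrzMnC -mulrz_natM => pa0.
have : ((p ^ n.+1)%:Z %| p%:Z * a)%Z.
  by apply: (primeX_dvdz_of_notin (subgroup_set0 V)) pa0.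
rewrite expnS PoszM dvdz_mul2l ?eqz_nat -?lt0n ?prime_gt0 // => na.
by exists 0 => //; exists (a %/ (p ^ n)%:Z)%Z; rewrite // !add0r -mulrz_dvdz.
Qed.

Lemma nat_switch (P : nat -> Prop) m : P 0%N -> ~ P m -> exists k, P k /\ ~ P k.+1.
Proof.
move=> P0 nPm; apply: contrapT => noswitch; apply: nPm.
elim: m => // m Pm; apply: contrapT => nPm; apply: noswitch.
by exists m.
Qed.

Lemma exists_last_multiple_notin D x : p_group V p -> D 0 -> ~ D x ->
  exists i, ~ D (x *+ p ^ i) /\ D (x *+ p ^ i *+ p).
Proof.
move=> pV D0 nDx; have [k xk] := pV x.
have [||i [ni /contrapT pi]] := @nat_switch (fun i => ~ D (x *+ p ^ i)) k.
- by rewrite expn0 mulr1n.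
- by rewrite xk.
- by exists i; rewrite mulrn_expSr.
Qed.

Lemma exists_socle_multiple x : p_group V p -> x <> 0 ->
  exists i, x *+ p ^ i <> 0 /\ x *+ p ^ i *+ p = 0.
Proof. by move=> pV; apply: (@exists_last_multiple_notin [set 0]). Qed.

End PrimePowers.

(** * Heights, neat and pure subgroups *)

Section Heights.
Variables (p : nat) (V : zmodType).
Hypothesis p_pr : prime p.
Implicit Types (A D H W : set V) (x y : V).

Definition height_ge k : set V := multiples [set: V] (p ^ k).

Lemma subgroup_height_ge k : subgroup (height_ge k).
Proof. exact/subgroup_multiples/subgroupT. Qed.

Lemma height_ge_mulrn k x : height_ge k (x *+ p ^ k). Proof. by exists x. Qed.

Lemma height_ge0 x : height_ge 0 x. Proof. by exists x. Qed.

Lemma height_geW k l : (k <= l)%N -> height_ge l `<=` height_ge k.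
Proof. by move=> /subnK <- _ [x _ <-]; exists (x *+ p ^ (l - k)); rewrite ?mulrn_expD. Qed.

Lemma height_geM k l x : height_ge k x -> height_ge (k + l) (x *+ p ^ l).
Proof. by move=> [y _ <-]; exists y; rewrite ?mulrn_expD. Qed.

Lemma torsionX_multiples A m j : subgroup A -> torsion A p `<=` multiples A (p ^ m) ->
  (j <= m.+1)%N -> torsion A (p ^ j) `<=` multiples A (p ^ (m.+1 - j)).
Proof.
move=> sA socA; elim: j => [_ x [_]|j IHj jm x [Ax xj]].
  by rewrite expn0 mulr1n => ->; apply: subgroup0 (subgroup_multiples _ sA).
have [|w Aw wE] := socA (x *+ p ^ j); first by split; [apply: subgroupMn | rewrite mulrn_expSr].
have sM := subgroup_multiples (p ^ (m.+1 - j.+1)) sA.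
rewrite -(subrK (w *+ p ^ (m.+1 - j.+1)) x); apply: subgroupD => //; last by exists w.
have [|y Ay <-] := IHj (ltnW jm) (x - w *+ p ^ (m.+1 - j.+1)).
  split; first by apply: subgroupB => //; apply: subgroupMn.
  by rewrite mulrnBl mulrn_expD subSS subnK // wE subrr.
by exists (y *+ p); [apply: subgroupMn | rewrite mulrn_expS subSS -subSn].
Qed.

Lemma socle_multiples A m : subgroup A -> torsion A (p ^ m) `<=` multiples A p ->
  torsion A p `<=` multiples A (p ^ m).
Proof.
move=> sA Am t [At pt]; suff: forall j, (j <= m)%N -> multiples A (p ^ j) t by apply.
elim=> [|j IHj] jm; first by exists t.
have [u Au uE] := IHj (ltnW jm); have [|w Aw wE] := Am u.
  split=> //; rewrite -(subnKC jm) -mulrn_expD -mulrn_expSr uE pt mul0rn //.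
by exists w; rewrite // -mulrn_expS wE uE.
Qed.

Lemma p_divisibleX A k : A `<=` multiples A p -> A `<=` multiples A (p ^ k).
Proof.
move=> divA; elim: k => [|k IHk] x Ax; first by exists x.
have [y Ay <-] := IHk x Ax; have [w Aw <-] := divA y Ay.
by exists w; rewrite ?mulrn_expS.
Qed.

Definition neat A D := forall y, A y -> D (y *+ p) -> multiples D p (y *+ p).

Definition pure D := forall k, D `&` height_ge k `<=` multiples D (p ^ k).

Lemma maximal_in_neat A W D : subgroup A ->
  maximal_in (A `&` [set x | x *+ p = 0 -> W x]) D -> neat A D.
Proof.
move=> sA [sD DQ maxD] y Ay Dpy; apply: contrapT => nDpy; apply: (nDpy); exists y => //.
apply: maxD => _ [d Dd [a _ <-]]; have [Ad Wd] := DQ d Dd.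
split=> [|/= da0]; first by apply: subgroupD => //; apply: subgroupMz.
have pa : (p%:Z %| a)%Z.
  apply: (prime_dvdz_of_notin p_pr (subgroup_multiples p sD) _ nDpy); first by exists (y *+ p).
  exists (- d); first exact: subgroupN.
  by rewrite mulNrn -mulrzMnC; apply: addr0_eq; rewrite -mulrnDl.
suff [_] : (A `&` [set x | x *+ p = 0 -> W x]) (d + y *~ a) by apply.
apply: DQ; apply: subgroupD => //; exact: subgroupMz_dvdz pa Dpy.
Qed.

Lemma neat_pure m D : torsion setT p `<=` height_ge m -> subgroup D -> neat setT D ->
  D `&` height_ge m.+2 `<=` [set 0] -> pure D.
Proof.
move=> socm sD neatD Dm k; elim: k => [|k IHk] d [Dd dk]; first by exists d.
have [lt_mk|le_km] := ltnP m.+1 k.+1.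
  have -> : d = 0 by apply: Dm; split=> //; apply: height_geW dk.
  exact: (subgroup0 (subgroup_multiples _ sD)).
have [y _ dE] := dk; rewrite -mulrn_expSr in dE.
have [|e De eE] := neatD (y *+ p ^ k) I; first by rewrite dE.
have ke : height_ge k e.
  rewrite -(subrK (y *+ p ^ k) e); apply: subgroupD (height_ge_mulrn _ _).
    exact: subgroup_height_ge.
  by apply: (@height_geW _ m) => //; apply: socm; split; rewrite // mulrnBl eE subrr.
have [f Df fE] := IHk e (conj De ke).
by exists f => //; rewrite -mulrn_expSr fE eE.
Qed.

Hypothesis pV : p_group V p.

Lemma p_divisible_divisible : [set: V] `<=` multiples setT p -> divisible V.
Proof.
move=> divp x n n_gt0.
have div k : forall z, height_ge k z.
  elim: k => [|k IHk] z; first exact: height_ge0.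
  have [y _ <-] := IHk z; have [u _ <-] := divp y I.
  by rewrite mulrn_expS; apply: height_ge_mulrn.
have [y _ xE] := div (logn p n) x.
have [l yl] := pV y.
have /coprimezP[[u v] /= uv] : coprimez (n`_p^')%:Z (p ^ l)%:Z.
  rewrite /coprimez /gcdz eqz_nat -/(coprime _ _) coprime_sym coprimeXl //.
  exact: pnat_coprime (pnat_id p_pr) (part_pnat _ _).
exists (y *~ u); rewrite -(partnC p n_gt0) p_part mulnC mulrnA -xE; congr (_ *+ _).
rewrite -[RHS]mulr1z -uv mulrzDr [v * _]mulrC mulrz_natM yl mul0rz addr0.
by rewrite pmulrn -mulrzA.
Qed.

Lemma exists_minimal_order_element : ~ divisible V -> exists m x,
  [/\ x *+ p ^ m.+1 = 0, ~ height_ge m.+1 (x *+ p ^ m) & torsion [set: V] p `<=` height_ge m].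
Proof.
move=> ndiv; have [x0 nx0] : exists x, ~ multiples [set: V] p x.
  apply/existsNP => divp; apply: ndiv; apply: p_divisible_divisible => x _.
  exact: divp.
have sM := subgroup_multiples p (subgroupT V).
have [k x0k] := pV x0.
have [|| m [socm /existsNP[x /not_implyP[[_ xm] nx]]]] :=
    @nat_switch (fun j => torsion [set: V] (p ^ j) `<=` multiples setT p) k.
- by move=> x [_]; rewrite expn0 mulr1n => ->; apply: subgroup0.
- by move=> sock; apply: nx0; apply: sock.
exists m, x; split=> //; last exact: socle_multiples.
move=> [w _ wE]; apply: nx; rewrite -(subrK (w *+ p) x); apply: subgroupD => //; last by exists w.
by apply: socm; split=> //; rewrite mulrnBl mulrn_expS wE subrr.
Qed.

Lemma trivial_of_socle A : subgroup A -> torsion A p `<=` [set 0] -> A `<=` [set 0].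
Proof.
move=> sA A0 x Ax; apply: contrapT => /(exists_socle_multiple pV)[i [ni pi]].
by apply: ni; apply: A0; split=> //; apply: subgroupMn.
Qed.

Lemma socle_essential H D : torsion D p `<=` H -> essential H D.
Proof.
move=> DH S sS SD [s [Ss /(exists_socle_multiple pV)[i [ni pi]]]].
have Si : S (s *+ p ^ i) by apply: subgroupMn.
by exists (s *+ p ^ i); split=> //; split=> //; apply: DH; split=> //; apply: SD.
Qed.

Lemma essential_socle H D : subgroup D -> subgroup H -> essential H D -> torsion D p `<=` H.
Proof.
move=> sD sH essD t [Dt pt]; have [->|/eqP t0] := eqVneq t 0; first exact: subgroup0.
have s0 := subgroup_set0 V.
have [||_ [[_ -> [a _ <-]] [Ha]]] := essD (adjoin [set 0] t) (subgroup_adjoin t s0).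
- by move=> _ [_ -> [a _ <-]]; rewrite add0r; apply: subgroupMz.
- by exists t; split=> //; apply: mem_adjoin.
rewrite add0r in Ha *; move=> a0; apply: contrapT => nHt.
apply: a0; apply: (mulrz_eq0_dvdz _ pt); apply: (prime_dvdz_of_notin p_pr sH _ nHt) => //.
by rewrite pt; apply: subgroup0.
Qed.

Lemma exists_essential_neat_hull A H : subgroup A -> subgroup H -> H `<=` A ->
  exists D, [/\ subgroup D, H `<=` D, D `<=` A, essential H D & neat A D].
Proof.
move=> sA sH HA; pose Q := A `&` [set x | x *+ p = 0 -> H x].
have [|D HD maxD] := @exists_maximal_in _ Q H sH; first by move=> x Hx; split; [apply: HA|].
have neatD := maximal_in_neat sA maxD; have [sD DQ _] := maxD.
exists D; split=> // [x /DQ[]//|].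
by apply: socle_essential => x [/DQ[_ Hx] /Hx].
Qed.

End Heights.

(** * Extension of homomorphisms and direct summands *)

Section Extension.
Variables (p : nat) (V W : zmodType).
Hypotheses (p_pr : prime p) (pV : p_group V p).
Implicit Types (E T Q : set (V * W)) (H M : set W).

Lemma pairB (x x' : V) (y y' : W) : (x, y) - (x', y') = (x - x', y - y').
Proof. by []. Qed.

Lemma pair_mulz (x : V) (y : W) (a : int) : (x, y) *~ a = (x *~ a, y *~ a).
Proof. by rewrite [LHS]surjective_pairing !raddfMz. Qed.

Definition domain E : set V := [set x | exists y, E (x, y)].

Lemma subgroup_domain E : subgroup E -> subgroup (domain E).
Proof.
move=> sE; split; first by exists 0; apply: (subgroup0 sE).
by move=> x x' [y Ey] [y' Ey']; exists (y - y'); apply: (subgroupB sE Ey Ey').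
Qed.

(* [E] is the graph of a homomorphism from [domain E] to [M / H]. *)
Definition hom_graph H M E :=
  [/\ subgroup E, forall x y, E (x, y) -> M y & forall y, E (0, y) -> H y].

Lemma extend_graph Q T : subgroup T -> T `<=` Q ->
  (forall E, subgroup E -> T `<=` E -> E `<=` Q ->
     forall u, ~ domain E u -> domain E (u *+ p) ->
     exists u' v, ~ domain E u' /\ adjoin E (u', v) `<=` Q) ->
  exists E, [/\ subgroup E, T `<=` E, E `<=` Q & forall x, domain E x].
Proof.
move=> sT TQ step; have [E TE [sE EQ maxE]] := exists_maximal_in sT TQ.
exists E; split=> // x; apply: contrapT => nx.
have sdom := subgroup_domain sE.
have [i [ni pi]] := exists_last_multiple_notin pV (subgroup0 sdom) nx.
have [u [v [nu uvQ]]] := step E sE TE EQ _ ni pi.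
by apply: nu; exists v; apply: maxE.
Qed.

Lemma extend_hom_divisible H M T : subgroup H -> subgroup M -> H `<=` M ->
  M `<=` sumset H (multiples M p) -> hom_graph H M T ->
  exists E, [/\ hom_graph H M E, T `<=` E & forall x, domain E x].
Proof.
move=> sH sM HM divM [sT TM T0].
have [|E sE _ EQ u nu [v Euv]|E [sE TE EQ Edom]] :=
    @extend_graph [set z | M z.2 /\ (z.1 = 0 -> H z.2)] T sT.
- by move=> [x y] Txy; split=> /= [|x0]; [apply: TM Txy | apply: T0; rewrite -x0].
- have [/= Mv _] := EQ _ Euv; have [h Hh [_ [m Mm <-] vE]] := divM _ Mv.
  exists u, m; split=> // _ [[x y] Exy [a _ <-]]; rewrite pair_mulz.
  split=> /= [|xu0]; first by apply: subgroupD (subgroupMz _ sM Mm) => //; case: (EQ _ Exy).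
  have sdom := subgroup_domain sE.
  have /dvdzP[b aE] : (p%:Z %| a)%Z.
    apply: (prime_dvdz_of_notin p_pr sdom _ nu); first by exists v.
    by rewrite -(addr0_eq xu0); exists (- y); apply: (subgroupN sE Exy).
  have [_ /=] := EQ _ (subgroupD sE Exy (subgroupMz b sE Euv)).
  rewrite pair_mulz /= -mulrz_natM [_ * b]mulrC -aE => /(_ xu0).
  rewrite -vE addrC mulrzDl -addrA aE mulrC mulrz_natM [m *+ p *~ b + y]addrC => Hy.
  rewrite -(addKr (h *~ b) (y + _)); apply: subgroupD => //.
  by apply: subgroupN => //; apply: subgroupMz.
- exists E; split=> //; split=> // [x y /EQ[]//|y /EQ[_]]; exact.
Qed.

End Extension.

Section Summands.
Variables (p : nat) (G : zmodType).
Hypotheses (p_pr : prime p) (pG : p_group G p).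
Implicit Types (C D : set G) (E : set (G * G)).

Lemma summand_pure D : direct_summand D -> pure p D.
Proof.
move=> [C [sD [sC [dis gen]]]] k d [Dd [g _ gE]].
have [a [b [Da [Cb gab]]]] := gen g; exists a => //.
rewrite -gE gab mulrnDl (dis (b *+ p ^ k)) ?addr0 //; last exact: subgroupMn.
rewrite -(addKr (a *+ p ^ k) (b *+ _)) -mulrnDl -gab gE addrC.
by apply: subgroupB => //; apply: subgroupMn.
Qed.

Lemma retract_summand D E : subgroup D -> hom_graph [set 0] D E -> (forall x, domain E x) ->
  (forall d, D d -> E (d, d)) -> int_direct_sum D [set x | E (x, 0)].
Proof.
move=> sD [sE ED E0] Edom EI; split=> //; split.
  split; first exact: (subgroup0 sE).
  by move=> x y Ex Ey; have := subgroupB sE Ex Ey; rewrite pairB subrr.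
split=> [d Dd Ed|x].
  apply: E0; have := subgroupB sE (EI d Dd) Ed.
  by rewrite pairB subrr subr0.
have [y Exy] := Edom x; have Dy := ED _ _ Exy.
exists y, (x - y); split=> //; split; last by rewrite addrC subrK.
by have := subgroupB sE Exy (EI y Dy); rewrite pairB subrr.
Qed.

Lemma divisible_summand D : subgroup D -> D `<=` multiples D p -> direct_summand D.
Proof.
move=> sD divD; have s0 := subgroup_set0 G.
have [|||E [gE DE Edom]] := @extend_hom_divisible p G G p_pr pG [set 0] D
    [set (d, d) | d in D] s0 sD.
- by move=> _ ->; apply: subgroup0.
- exact: subset_trans divD (sub_sumsetr s0).
- split=> [|_ _ [d Dd [_ <-]] //|y [d _ [-> <-]] //]; split.
    by exists 0 => //; apply: subgroup0.
  by move=> _ _ [d Dd <-] [e De <-]; exists (d - e) => //; apply: subgroupB.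
by exists [set x | E (x, 0)]; apply: retract_summand => // d Dd; apply: DE; exists d.
Qed.

Definition height_nondecreasing D : set (G * G) :=
  [set z | D z.2 /\ forall j, height_ge p j z.1 -> multiples D (p ^ j) z.2].

(* A generator [u] of maximal height in its coset can be sent to any element whose height is
   at least that of [u]. *)
Lemma extend_height_nondecreasing D E i u v : subgroup D -> subgroup E ->
  E `<=` height_nondecreasing D -> height_ge p i u ->
  ~ sumset (domain E) (height_ge p i.+1) u -> E (u *+ p, v) ->
  exists w, adjoin E (u, w) `<=` height_nondecreasing D.
Proof.
move=> sD sE Eh iu nu Ev.
have sdom := subgroup_domain sE; have sG k := subgroup_height_ge p G k.
have [_ /(_ i.+1)[/=|d Dd /= vE]] := Eh _ Ev; first by rewrite -addn1; apply: height_geM.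
exists (d *+ p ^ i) => _ [[x y] Exy [a _ <-]]; rewrite pair_mulz.
have [/= Dy hy] := Eh _ Exy.
split=> /= [|j hj]; first by apply: subgroupD => //; apply: subgroupMz => //; apply: subgroupMn.
have [/dvdzP[b aE]|npa] := boolP (p%:Z %| a)%Z.
  have := Eh _ (subgroupD sE Exy (subgroupMz b sE Ev)); rewrite pair_mulz => -[/= _ /(_ j)].
  rewrite -vE -mulrn_expSr -!mulrz_natM [_ * b]mulrC -aE; exact.
have ji : (j <= i)%N.
  rewrite leqNgt; apply/negP => ij; move/negP: npa; apply.
  apply: (prime_dvdz_of_notin p_pr (subgroup_sumset sdom (sG i.+1)) _ nu).
    by apply: sub_sumsetl => //; exists v.
  exists (- x); first by exists (- y); apply: (subgroupN sE Exy).
  by exists (x + u *~ a); rewrite ?addKr //; apply: height_geW ij _ hj.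
have hja : height_ge p j (u *~ a) by apply: subgroupMz => //; apply: height_geW ji _ iu.
apply: subgroupD; first exact: subgroup_multiples.
  by apply: hy; rewrite -(addrK (u *~ a) x); apply: subgroupB.
apply: subgroupMz; first exact: subgroup_multiples.
exists (d *+ p ^ (i - j)); first exact: subgroupMn.
by rewrite mulrn_expD subnK.
Qed.

Lemma projection_height_nondecreasing m D d g : subgroup D -> pure p D ->
  multiples D (p ^ m) `<=` [set 0] -> D d -> height_nondecreasing D (d + g *+ p ^ m, d).
Proof.
move=> sD purD Dm Dd; split=> //= j hj.
have hd k : (k <= j)%N -> (k <= m)%N -> height_ge p k d.
  move=> kj km; rewrite -(addrK (g *+ p ^ m) d).
  apply: subgroupB; [exact: subgroup_height_ge | exact: height_geW kj _ hj |].
  exact: height_geW km _ (height_ge_mulrn _ _ _).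
have [jm|/ltnW mj] := leqP j m; first by apply: purD; split=> //; apply: hd.
have -> : d = 0 by apply: Dm; apply: purD; split=> //; apply: hd.
exact: subgroup0 (subgroup_multiples _ sD).
Qed.

(* Heights are bounded modulo a subgroup containing [p^m G], so every coset of it outside the
   domain has an element of maximal height. *)
Lemma extend_pure_projection m D : subgroup D -> pure p D -> multiples D (p ^ m) `<=` [set 0] ->
  exists E, [/\ hom_graph [set 0] D E, forall d g, D d -> E (d + g *+ p ^ m, d) &
    forall x, domain E x].
Proof.
move=> sD purD Dm.
pose T : set (G * G) := [set (d + g *+ p ^ m, d) | d in D & g in [set: G]].
have TE d g : D d -> T (d + g *+ p ^ m, d) by exists d => //; exists g.
have sT : subgroup T.
  split; first by have := TE 0 0 (subgroup0 sD); rewrite mul0rn addr0.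
  move=> _ _ [d Dd [g _ <-]] [e De [h _ <-]].
  by rewrite pairB opprD addrACA -mulrnBl; apply: TE; apply: subgroupB.
have [|E sE TsE Eh u nu pu|E [sE TsE Eh Edom]] := extend_graph pG sT (Q := height_nondecreasing D).
- by move=> _ [d Dd [g _ <-]]; apply: projection_height_nondecreasing.
- have sdom := subgroup_domain sE.
  have [||i [[s Es [w iw uE]] ni]] := @nat_switch (fun i => sumset (domain E) (height_ge p i) u) m.
  + by apply: sub_sumsetr => //; apply: height_ge0.
  + move=> [s Es [_ [g _ <-] suE]]; apply: nu; rewrite -suE; apply: subgroupD => //.
    by exists 0; apply: TsE; have := TE 0 g (subgroup0 sD); rewrite add0r.
  have [v Ev] : domain E (w *+ p).
    rewrite -(addKr s w) uE mulrnDl mulNrn; apply: subgroupD => //.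
    by apply: subgroupN => //; apply: subgroupMn.
  have [|y wy] := extend_height_nondecreasing sD sE Eh iw _ Ev.
    move=> Sw; apply: ni; rewrite -uE; apply: subgroupD => //.
      exact/subgroup_sumset/subgroup_height_ge.
    by apply: sub_sumsetl => //; apply: subgroup_height_ge.
  by exists w, y; split=> // Ew; apply: nu; rewrite -uE; apply: subgroupD.
- exists E; split=> //; last by move=> d g Dd; apply/TsE/TE.
  split=> // [x y /Eh[]//|y /Eh[/= _ /(_ m) ym]]; apply/Dm/ym.
  exact: subgroup0 (subgroup_height_ge _ _ _).
Qed.

Lemma pure_bounded_summand m D : subgroup D -> pure p D -> multiples D (p ^ m) `<=` [set 0] ->
  exists2 C, int_direct_sum D C & height_ge p m `<=` C.
Proof.
move=> sD purD Dm; have [E [gE TE Edom]] := extend_pure_projection sD purD Dm.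
exists [set x | E (x, 0)].
  by apply: retract_summand => // d Dd; have := TE d 0 Dd; rewrite mul0rn addr0.
by move=> _ [g _ <-]; have := TE 0 g (subgroup0 sD); rewrite add0r.
Qed.

Lemma neat_bounded_summand m D : torsion [set: G] p `<=` height_ge p m -> subgroup D ->
  neat p setT D -> D `&` height_ge p m.+2 `<=` [set 0] ->
  exists2 C, int_direct_sum D C & height_ge p m.+2 `<=` C.
Proof.
move=> socm sD neatD Dm; apply: pure_bounded_summand => //; first exact: neat_pure neatD Dm.
move=> _ [d Dd <-]; apply: Dm; split; last exact: height_ge_mulrn.
exact: subgroupMn.
Qed.

End Summands.

(** * Finite sets and independent families *)

Lemma finite_setE (G : zmodType) (A : set G) : Defs.finite_set A <-> finite_set A.
Proof.
split=> [[s As]|/finite_seqP[s ->]]; last by exists s.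
by apply: sub_finite_set (finite_seq s) => x /As.
Qed.

Lemma finite_inj_surj (T : choiceType) (A : set T) (f : T -> T) : finite_set A ->
  (forall x, A x -> A (f x)) -> (forall x y, A x -> A y -> f x = f y -> x = y) ->
  forall y, A y -> exists2 x, A x & f x = y.
Proof.
move=> /finite_fsetP[X ->] /= fX f_inj y yX.
have fXX : [fset f x | x in X]%fset = X.
  apply/eqP; rewrite eqEfcard card_in_imfset ?leqnn ?andbT //=.
  by apply/fsubsetP => _ /imfsetP[x /= xX ->]; apply: fX.
have : y \in [fset f x | x in X]%fset by rewrite fXX.
by move=> /imfsetP[x /= xX ->]; exists x.
Qed.

Section Finiteness.
Variables (p : nat) (V : zmodType).
Implicit Types (A D : set V).

Lemma finite_of_multiples_torsion D n : subgroup D -> finite_set (multiples D n) ->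
  finite_set (torsion D n) -> finite_set D.
Proof.
move=> sD finM finT.
have /choice[q qP] : forall y, exists x, multiples D n y -> D x /\ x *+ n = y.
  by move=> y; case: (pselect (multiples D n y)) => [[x Dx <-]|]; [exists x | exists 0].
apply: sub_finite_set (finite_image2 (fun x t => q x + t) finM finT) => x Dx.
have [|Dq qE] := qP (x *+ n); first by exists x.
exists (x *+ n); first by exists x.
exists (x - q (x *+ n)); last by rewrite addrC subrK.
by split; [apply: subgroupB | rewrite mulrnBl qE subrr].
Qed.

Lemma finite_torsionX D k : subgroup D -> finite_set (torsion D p) ->
  finite_set (torsion D (p ^ k)).
Proof.
move=> sD fin; elim: k => [|k IHk].
  by apply: sub_finite_set (finite_set1 0) => x [_]; rewrite expn0 mulr1n.
apply: (@finite_of_multiples_torsion _ p); first exact: subgroup_torsion.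
  apply: sub_finite_set IHk => _ [x [Dx xk] <-].
  by split; [apply: subgroupMn | rewrite mulrn_expS].
by apply: sub_finite_set fin => x [[Dx _] xp].
Qed.

Lemma finite_adjoin D x : prime p -> finite_set D -> x *+ p = 0 -> finite_set (adjoin D x).
Proof.
move=> p_pr finD px.
apply: sub_finite_set (finite_image2 (fun d k => d + x *+ k) finD (finite_II p)).
have p_neq0 : p%:Z != 0 by rewrite eqz_nat -lt0n prime_gt0.
move=> _ [d Dd [a _ <-]]; exists d => //; exists `|(a %% p)%Z|%N.
  by rewrite /= -ltz_nat gez0_abs ?modz_ge0 // ltz_pmod // ltz_nat prime_gt0.
rewrite [X in _ = _ + _ *~ X](divz_eq a p) mulrzDr [_ * p%:Z]mulrC mulrz_natM px mul0rz add0r.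
by rewrite pmulrn gez0_abs ?modz_ge0.
Qed.

Lemma finite_set_exponent A : p_group V p -> finite_set A ->
  exists t, A `<=` torsion setT (p ^ t).
Proof.
move=> pV /finite_seqP[s ->]; elim: s => [|x s [t st]]; first by exists 0%N.
have [k xk] := pV x; exists (k + t)%N => y /=; rewrite inE => /predU1P[->|/st[_ yt]].
  by split=> //; rewrite -mulrn_expD xk mul0rn.
by split=> //; rewrite addnC -mulrn_expD yt mul0rn.
Qed.

End Finiteness.

Section Independence.
Variable V : zmodType.
Implicit Types (T : set V).

Definition independent_on (K : choiceType) (X : set K) T (v : K -> V) (o : K -> nat) :=
  forall q, supported X q -> T (lincomb v q) -> forall k, ((o k)%:Z %| q@_k)%Z.

Definition independent (K : choiceType) T (v : K -> V) (o : K -> nat) :=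
  forall q, T (lincomb v q) -> forall k, ((o k)%:Z %| q@_k)%Z.

Lemma independent_on_comp (K L : choiceType) (X : set L) T v o (f : K -> L) :
  injective f -> (forall k, X (f k)) -> independent_on X T v o ->
  independent T (v \o f) (o \o f).
Proof.
move=> f_inj Xf indv q Tq k; rewrite -(mcoeff_relabel q k f_inj); apply: indv.
  have sX := subgroup_supported X.
  by apply: (lincomb_subgroup sX) => j; apply: (subgroupMz _ sX); apply: supportedU.
by rewrite lincomb_relabel.
Qed.

Lemma independent_comp (K L : choiceType) T v o (f : K -> L) :
  injective f -> independent T v o -> independent T (v \o f) (o \o f).
Proof.
by move=> f_inj indv; apply: (@independent_on_comp _ _ setT) => // q _; apply: indv.
Qed.

Variable p : nat.
Hypothesis p_pr : prime p.

Section PrimeIndependence.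
Variables (K : choiceType) (T : set V).
Hypothesis sT : subgroup T.
Implicit Types (A X : set K) (v : K -> V).

Lemma independent_on_setU1 X v k : independent_on X T v (fun=> p) -> T (v k *+ p) ->
  ~ sumset T (zspan v X) (v k) -> independent_on (X `|` [set k]) T v (fun=> p).
Proof.
move=> indX Tk nk q Xq; have sS := subgroup_sumset sT (subgroup_zspan v X).
pose r := q - << q@_k *g k >>.
have Xr : supported X r.
  move=> j nXj; rewrite mcoeffB mcoeffU; have [<-|/eqP kj] := eqVneq k j; first by rewrite subrr.
  by rewrite subr0 Xq // => -[/nXj|/esym/kj].
have rq : lincomb v q = v k *~ q@_k + lincomb v r by rewrite raddfB /= lincombU addrC subrK.
move=> Tq; have pk : (p%:Z %| q@_k)%Z.
  apply: (prime_dvdz_of_notin p_pr sS _ nk); first exact: sub_sumsetl (subgroup_zspan _ _) _ Tk.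
  exists (lincomb v q) => //; exists (lincomb v (- r)); last by rewrite rq raddfN addrK.
  by exists (- r) => //; apply: subgroupN (subgroup_supported X) Xr.
have Tr : T (lincomb v r).
  rewrite -(addKr (v k *~ q@_k) (lincomb v r)) -rq addrC; apply: subgroupB => //.
  exact: subgroupMz_dvdz pk Tk.
move=> j; rewrite -(subrK << q@_k *g k >> q) mcoeffD mcoeffU.
by apply: rpredD; [apply: indX | apply: rpredMn].
Qed.

Lemma chain_bound (F : set (set K)) (s : seq K) : total_on F subset ->
  {in s, forall k, exists2 X, F X & X k} -> s = [::] \/ exists2 X, F X & {in s, forall k, X k}.
Proof.
move=> totF; elim: s => [|k s IHs] Fs; first by left.
right; have [X FX Xk] := Fs k (mem_head _ _).
have [|->|[Y FY Ys]] := IHs; first by move=> j js; apply: Fs; rewrite inE js orbT.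
  by exists X => // j; rewrite inE => /eqP->.
have [XY|YX] := totF _ _ FX FY.
  by exists Y => // j; rewrite inE => /predU1P[->|/Ys//]; apply: XY.
by exists X => // j; rewrite inE => /predU1P[->//|/Ys]; apply: YX.
Qed.

Lemma exists_maximal_independent A v : (forall k, A k -> T (v k *+ p)) ->
  exists X, [/\ X `<=` A, independent_on X T v (fun=> p) &
    forall k, A k -> sumset T (zspan v X) (v k)].
Proof.
move=> AT; pose P X := X `<=` A /\ independent_on X T v (fun=> p).
have [F FP totF|X [[XA indX] maxX]] := @Zorn_bigcup K P.
  split=> [k [X FX Xk]|q Fq Tq]; first by have [XA _] := FP _ FX; apply: XA.
  have [k|q0|[X FX Xq]] := @chain_bound F (msupp q) totF.
  - rewrite -mcoeff_neq0 => /eqP qk; apply: contrapT => nF; apply: qk; apply: Fq.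
    by move=> [X FX Xk]; apply: nF; exists X.
  - move=> k; rewrite mcoeff_outdom ?dvdz0 //; apply/negP.
    by rewrite -[k \in _]/(k \in (msupp q : seq K)) q0.
  - have [_ indX] := FP _ FX; apply: indX Tq => k nXk.
    by apply: mcoeff_outdom; apply/negP => /Xq.
exists X; split=> // k Ak; apply: contrapT => nk.
have nXk : ~ X k by move=> Xk; apply: nk; apply: sub_sumsetr => //; apply: mem_zspan.
apply: (maxX (X `|` [set k])).
  by split=> [x Xx|sub]; [left | apply: nXk; apply: sub; right].
by split=> [j [/XA|->]//|]; apply: independent_on_setU1 => //; apply: AT.
Qed.

Lemma independent_update v k z : independent (adjoin T z) v (fun=> p) ->
  (forall j, T (v j *+ p)) -> T (z *+ p) -> ~ T z ->
  independent T [eta v with k |-> z] (fun=> p).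
Proof.
move=> indv Tv Tz nTz q; set w := [eta v with k |-> z].
pose r := q - << q@_k *g k >>.
have rk : r@_k = 0 by rewrite mcoeffB mcoeffUU subrr.
have rv : lincomb w r = lincomb v r.
  by apply: eq_lincomb => j /=; case: eqP => // ->; rewrite rk !mulr0z.
have rq : lincomb w q = lincomb v r + z *~ q@_k.
  by rewrite -rv raddfB /= lincombU /= eqxx subrK.
move=> Tq; have pr j : (p%:Z %| r@_j)%Z.
  apply: indv; exists (lincomb w q) => //; exists (- q@_k) => //.
  by rewrite mulrNz rq addrK.
have Tr : T (lincomb v r).
  by apply: lincomb_subgroup => // j; apply: subgroupMz_dvdz (pr j) (Tv j).
have pk : (p%:Z %| q@_k)%Z.
  apply: (prime_dvdz_of_notin p_pr sT Tz nTz).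
  by rewrite -(addKr (lincomb v r) (z *~ _)) -rq addrC; apply: subgroupB.
move=> j; rewrite -(subrK << q@_k *g k >> q) mcoeffD mcoeffU.
by apply: rpredD; [apply: pr | apply: rpredMn].
Qed.

End PrimeIndependence.

Lemma independent_sum_type (I J : choiceType) (v : I + J -> V) T : subgroup T ->
  independent T (v \o inl) (fun=> p) -> independent [set 0] (v \o inr) (fun=> p) ->
  (forall i, v (inl i) *+ p = 0) -> (forall j, T (v (inr j))) ->
  independent [set 0] v (fun=> p).
Proof.
move=> sT indI indJ vI vJ q; have [qI [qJ [qIE qJE ->]]] := lincomb_sum_type q => q0.
have pI i : (p%:Z %| qI@_i)%Z.
  apply: indI; rewrite -(opprK (lincomb _ qI)) (addr0_eq q0); apply: subgroupN => //.
  by apply: lincomb_subgroup => // j; apply: subgroupMz => //; apply: vJ.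
move: q0; rewrite [X in X + _]lincomb_eq0 => [|i]; last first.
  exact: mulrz_eq0_dvdz (pI i) (vI i).
by rewrite add0r => /indJ pJ [i|j]; rewrite -?qIE -?qJE.
Qed.

Lemma independent_of_socle (K : choiceType) (v : K -> V) (b : K -> nat) :
  (forall k, v k *+ p ^ (b k).+1 = 0) ->
  independent [set 0] (fun k => v k *+ p ^ b k) (fun=> p) ->
  independent [set 0] v (fun k => p ^ (b k).+1)%N.
Proof.
move=> vb indv q vq.
have s0 := subgroup_set0 V.
have vb0 k : v k *+ p ^ b k <> 0.
  move=> vk0; have := indv << k >>; rewrite lincomb1 => /(_ vk0 k); rewrite mcoeffUU.
  by rewrite dvdzE /= dvdn1 => /eqP p1; have := p_pr; rewrite p1.
have order k (a : int) : v k *~ a = 0 -> ((p ^ (b k).+1)%:Z %| a)%Z.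
  by apply: (primeX_dvdz_of_notin p_pr s0) => //; apply: vb0.
suff: forall r, (forall k, v k *~ q@_k *+ p ^ r = 0) -> forall k, ((p ^ (b k).+1)%:Z %| q@_k)%Z.
  move=> /(_ (\max_(k <- msupp q) (b k).+1)); apply=> k.
  have [kq|/mcoeff_outdom->] := boolP (k \in msupp q); last by rewrite mulr0z mul0rn.
  by rewrite mulrzMnC -(subnKC (leq_bigmax_seq _ kq isT)) -mulrn_expD vb mul0rn mul0rz.
elim=> [|r IHr] qr k; first by apply: order; rewrite -(qr k) expn0.
have qM j : (q *+ p ^ r)@_j = q@_j * (p ^ r)%:Z by rewrite mcoeffMn -mulr_natr natz.
have [|d dE] := @malg_divz _ (fun k => p ^ b k)%N (q *+ p ^ r).
  move=> j; rewrite -(@dvdz_mul2r p%:Z) ?eqz_nat -?lt0n ?prime_gt0 // -PoszM -expnSr qM.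
  by apply: order; rewrite !mulrzA -!pmulrn mulrn_expSr.
have pd : forall j, (p%:Z %| d@_j)%Z.
  by apply: indv; rewrite -(lincomb_scale _ dE) raddfMn /= vq mul0rn.
apply: IHr => j; rewrite pmulrn -mulrzA -qM dE mulrz_natM.
by apply: mulrz_eq0_dvdz (pd j) _; rewrite mulrn_expSr.
Qed.

Lemma independent_socle_dvd (K : choiceType) (v : K -> V) (b : K -> nat) q :
  independent [set 0] v (fun k => p ^ (b k).+1)%N -> lincomb v q *+ p = 0 ->
  forall k, ((p ^ b k)%:Z %| q@_k)%Z.
Proof.
rewrite -raddfMn => indv /indv qp k; have := qp k.
by rewrite mcoeffMn -mulr_natr natz expnSr PoszM dvdz_mul2r // eqz_nat -lt0n prime_gt0.
Qed.

Lemma independent_of_chain (E : nat -> set V) (s : nat -> V) : (forall i, subgroup (E i)) ->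
  (forall i, E i `<=` E i.+1) -> (forall i, E i.+1 (s i)) -> (forall i, ~ E i (s i)) ->
  (forall i, s i *+ p = 0) -> independent (E 0%N) s (fun=> p).
Proof.
move=> sE Eincr Es nEs ps q.
have zE i : zspan s `I_i `<=` E i.
  apply: zspan_sub => // j /=; elim: i => // i IHi.
  by rewrite ltnS leq_eqVlt => /predU1P[->//|/IHi /Eincr].
have E0 i : E 0%N `<=` E i by elim: i => // i IHi; apply: subset_trans IHi (Eincr i).
have ind i : independent_on `I_i (E 0%N) s (fun=> p).
  elim: i => [|i IHi]; first by move=> r r0 _ k; rewrite r0 ?dvdz0.
  rewrite IIS; apply: independent_on_setU1 => //; first by rewrite ps; apply: subgroup0.
  move=> [x Ex [y /zE Ey xy]]; apply: (nEs i); rewrite -xy.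
  by apply: subgroupD => //; apply: E0 Ex.
apply: (ind (\max_(k <- msupp q) k).+1) => k /= /negP; rewrite -leqNgt => kq.
apply: mcoeff_outdom; apply: contraL kq => kq; rewrite -ltnNge ltnS.
exact: leq_bigmax_seq.
Qed.

Lemma exists_independent_sequence D (S : nat -> set V) : subgroup D -> finite_set D ->
  (forall i, S i `<=` torsion setT p) -> (forall i, infinite_set (S i)) ->
  exists s : nat -> V, (forall i, S i (s i)) /\ independent D s (fun=> p).
Proof.
move=> sD finD Sp Sinf.
have /choice[next nextP] : forall E : set V * nat, exists x,
    finite_set E.1 -> S E.2 x /\ ~ E.1 x.
  move=> [E i]; case: (pselect (finite_set E)) => [finE|]; last by exists 0.
  have [x Sx] := infinite_setN0 (infinite_setD (Sinf i) finE).
  by exists x.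
pose E i := iteri i (fun j E => adjoin E (next (E, j))) D.
pose s i := next (E i, i).
have finE i : finite_set (E i).
  elim: i => //= i finEi; apply: (finite_adjoin p_pr) => //.
  by have [/Sp[]] := nextP (E i, i) finEi.
have sE i : subgroup (E i) by elim: i => //= i; apply: subgroup_adjoin.
exists s; split=> [i|]; first by case: (nextP (E i, i) (finE i)).
apply: (independent_of_chain sE) => i.
- exact: sub_adjoin.
- exact: mem_adjoin.
- by case: (nextP (E i, i) (finE i)).
- by have [/Sp[]] := nextP (E i, i) (finE i).
Qed.

End Independence.

(** * Divisibility at large heights *)

Section StableHeights.
Variables (p : nat) (V : zmodType).
Hypothesis pV : p_group V p.

Lemma finite_socle_stable k : finite_set (torsion (height_ge p k) p : set V) ->
  exists2 N, (k <= N)%N &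
    torsion (height_ge p N) p `<=` [set x : V | forall j, height_ge p j x].
Proof.
move=> /finite_seqP[s sE].
suff [N kN sN] : exists2 N, (k <= N)%N &
    {in s, forall x, height_ge p N x -> forall j, height_ge p j x}.
  exists N => // x [Nx px]; apply: sN => //.
  have : [set` s] x by rewrite -sE; split=> //; apply: height_geW Nx.
  by [].
elim: s {sE} => [|x s [N kN IHs]]; first by exists k.
case: (pselect (forall j, height_ge p j x)) => [px|/existsNP[j npx]].
  by exists N => // y; rewrite inE => /predU1P[->|/IHs].
exists (maxn N j) => [|y]; first by rewrite leq_max kN.
rewrite inE => /predU1P[->|ys] hy; first by case: npx; apply: height_geW hy; apply: leq_maxr.
by apply: IHs => //; apply: height_geW hy; apply: leq_maxl.
Qed.

Lemma stable_socle_divisible N :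
  torsion (height_ge p N) p `<=` [set x : V | forall j, height_ge p j x] ->
  (height_ge p N : set V) `<=` multiples (height_ge p N) p.
Proof.
move=> stN x; have [k] := pV x; have sN := subgroup_height_ge p V N.
elim: k x => [|k IHk] x xk Nx.
  by exists 0; [apply: subgroup0 | rewrite mul0rn -xk expn0 mulr1n].
have [|w _ wE] := stN (x *+ p ^ k) _ (N + k).+1.
  by split; [apply: subgroupMn | rewrite mulrn_expSr].
have Nw := height_ge_mulrn p N w.
have [||y Ny yE] := IHk (x - w *+ p ^ N *+ p).
- by rewrite mulrnBl mulrn_expS mulrn_expD addnS wE subrr.
- by apply: subgroupB => //; apply: subgroupMn.
exists (y + w *+ p ^ N); first exact: subgroupD.
by rewrite mulrnDl yE subrK.
Qed.

Lemma finite_socle_divisible k : finite_set (torsion (height_ge p k) p : set V) ->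
  exists2 N, (k <= N)%N & (height_ge p N : set V) `<=` multiples (height_ge p N) p.
Proof.
by move=> /finite_socle_stable[N kN stN]; exists N => //; apply: stable_socle_divisible.
Qed.

End StableHeights.

(** * Sufficiency *)

Section Embeddings.
Variable G : zmodType.
Implicit Types (H : set G) (f : G -> G).

Definition embeds_in_quotient H := exists f, hom_to_quot H f /\ inj_to_quot H f.

Lemma hom_to_quot0 H f : subgroup H -> hom_to_quot H f -> H (f 0).
Proof.
move=> sH hf; have := hf 0 0; rewrite addr0 opprD addrA subrr sub0r.
by move=> /(subgroupN sH); rewrite opprK.
Qed.

Lemma hom_to_quotMn H f x n : subgroup H -> hom_to_quot H f -> H (f (x *+ n) - f x *+ n).
Proof.
move=> sH hf; elim: n => [|n IHn].
  by rewrite !mulr0n subr0; apply: hom_to_quot0 sH hf.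
rewrite !mulrS -(subrKA (f x + f (x *+ n))); apply: subgroupD => //.
by rewrite opprD addrACA subrr add0r.
Qed.

Lemma hom_to_quot_torsion H f x n : subgroup H -> hom_to_quot H f -> x *+ n = 0 -> H (f x *+ n).
Proof.
move=> sH hf xn; rewrite -(subKr (f 0) (f x *+ n)); apply: subgroupB => //.
  exact: hom_to_quot0 sH hf.
by rewrite -xn; apply: hom_to_quotMn sH hf.
Qed.

Lemma embeds_in_quotient0 : embeds_in_quotient [set 0].
Proof. by exists id; split=> x y /=; rewrite ?subrr // => /eqP; rewrite subr_eq0 => /eqP. Qed.

Lemma embeds_in_quotient_comp (E H : set G) (e : {additive G -> G}) :
  (forall x, H (e x) <-> E x) -> embeds_in_quotient E -> embeds_in_quotient H.
Proof.
move=> HE [f [hf injf]]; exists (e \o f); split=> x y /=.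
  by rewrite -raddfD -raddfB; apply/HE.
by rewrite -raddfB => /HE /injf.
Qed.

End Embeddings.

Section Sufficiency.
Variables (p : nat) (G : zmodType).
Hypotheses (p_pr : prime p) (pG : p_group G p).
Implicit Types (H : set G) (f : G -> G).

Lemma divisible_sgb : divisible G -> semi_generalized_bassian G.
Proof.
move=> divG H sH _.
have [D [sD HD _ essD neatD]] :=
  exists_essential_neat_hull p_pr pG (subgroupT G) sH (@subsetT _ H).
exists D; split=> //; split=> //; apply: (divisible_summand p_pr pG) => // d Dd.
by have [y yd] := divG d p (prime_gt0 p_pr); rewrite -yd; apply: neatD; rewrite ?yd.
Qed.

(* For [x] in [G[p^j]] and [k] in [H[p^t]] write [b = f x + k] and let [q] divide by [p^j].
   The pair [(b - q, p^j b)] lies again in [G[p^j] * H[p^t]], and determines [(x, k)]. *)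
Lemma finite_rank_kernel_height H f : finite_set (torsion [set: G] p) -> subgroup H ->
  hom_to_quot H f -> inj_to_quot H f -> forall j, H `<=` height_ge p j.
Proof.
move=> finG sH hf injf j h Hh; pose X := torsion [set: G] (p ^ j).
have finX k : finite_set (torsion [set: G] (p ^ k)) := finite_torsionX k (subgroupT G) finG.
have [|t] := @finite_set_exponent p G (h |` f @` X) pG.
  by rewrite finite_setU; split; [apply: finite_set1 | apply: finite_image (finX j)].
rewrite subUset => -[/(_ h erefl)[_ ht] ft].
pose K := torsion H (p ^ t); have finK : finite_set K.
  by apply: sub_finite_set (finX t) => x [].
have /choice[q qP] : forall y : G, exists u, height_ge p j y -> u *+ p ^ j = y.
  by move=> y; case: (pselect (height_ge p j y)) => [[u _ <-]|]; [exists u | exists 0].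
have {}qP b : q (b *+ p ^ j) *+ p ^ j = b *+ p ^ j by apply/qP/height_ge_mulrn.
pose swap (z : G * G) := let b := f z.1 + z.2 in (b - q (b *+ p ^ j), b *+ p ^ j).
have XKswap z : (X `*` K) z -> (X `*` K) (swap z).
  case: z => x k [/= [_ xj] [Hk kt]]; split; split=> //=.
  - by rewrite mulrnBl qP subrr.
  - rewrite mulrnDl; apply: subgroupD => //; last exact: subgroupMn.
    exact: (hom_to_quot_torsion sH hf).
  - have [|_ fxt] := ft (f x); first by exists x.
    by rewrite -mulrnA mulnC mulrnA mulrnDl kt fxt addr0 mul0rn.
have swap_inj z z' : (X `*` K) z -> (X `*` K) z' -> swap z = swap z' -> z = z'.
  case: z z' => x k [x' k'] [/= _ [Hk _]] [/= _ [Hk' _]] [+ bE]; rewrite bE => /addIr E.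
  have xx' : x = x'.
    apply: injf; have -> : f x - f x' = k' - k; last exact: subgroupB.
    by apply/eqP; rewrite subr_eq addrAC [k' + _]addrC -E addrK.
  by move: E; rewrite xx' => /addrI ->.
have [|[x k] _ [_ <-]] := finite_inj_surj (finite_setX (finX j) finK) XKswap swap_inj (y := (0, h)).
  by split=> //=; split=> //; rewrite mul0rn.
exact: height_ge_mulrn.
Qed.

Lemma finite_rank_sgb : finite_p_rank G p -> semi_generalized_bassian G.
Proof.
move=> /finite_setE finG H sH [f [hf injf]].
have [|N _ divN] := @finite_socle_divisible p G pG 0.
  by apply: sub_finite_set finG => x [].
have HN : H `<=` height_ge p N.
  by apply: (finite_rank_kernel_height _ sH hf injf); apply: sub_finite_set finG => x [].
have [D [sD HD DN essD neatD]] :=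
  exists_essential_neat_hull p_pr pG (subgroup_height_ge p G N) sH HN.
exists D; split=> //; split=> //; apply: (divisible_summand p_pr pG) => // d Dd.
by have [y Ny yd] := divN d (DN d Dd); rewrite -yd; apply: neatD; rewrite ?yd.
Qed.

Lemma finite_height_kernel H f m : finite_set (height_ge p m : set G) -> subgroup H ->
  hom_to_quot H f -> inj_to_quot H f -> H `&` height_ge p m `<=` [set 0].
Proof.
move=> finm sH hf injf; have sm := subgroup_height_ge p G m.
have /choice[g gP] : forall x : G, exists y, height_ge p m x -> height_ge p m y /\ H (f x - y).
  move=> x; case: (pselect (height_ge p m x)) => [[u _ <-]|]; last by exists 0.
  by exists (f u *+ p ^ m); split; [apply: height_ge_mulrn | apply: (hom_to_quotMn u _ sH hf)].
have g_inj x y : height_ge p m x -> height_ge p m y -> g x = g y -> x = y.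
  move=> /gP[_ Hx] /gP[_ Hy] gxy; apply: injf; rewrite -(subrKA (g x)).
  by apply: subgroupD => //; rewrite gxy -opprB; apply: subgroupN.
have g0 h : H h -> height_ge p m h -> h = g 0.
  move=> Hh /(finite_inj_surj finm (fun x mx => (gP x mx).1) g_inj)[x mx gx].
  have [_ Hx] := gP x mx; rewrite -gx; congr (g _); apply: injf.
  apply: subgroupB (hom_to_quot0 sH hf) => //.
  by rewrite -(subrK (g x) (f x)); apply: subgroupD; rewrite // gx.
move=> h [Hh mh]; rewrite /= (g0 h Hh mh) -(g0 0) //; exact: subgroup0.
Qed.

Lemma finite_height_sgb m : torsion [set: G] p `<=` height_ge p m ->
  finite_set (height_ge p m.+2 : set G) -> semi_generalized_bassian G.
Proof.
move=> socm finm H sH [f [hf injf]].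
have [D [sD HD _ essD neatD]] :=
  exists_essential_neat_hull p_pr pG (subgroupT G) sH (@subsetT _ H).
have DH : torsion D p `<=` H by apply: essential_socle.
exists D; split=> //; split=> //.
have [|C DC _] := neat_bounded_summand p_pr pG socm sD neatD; last by exists C.
apply: (trivial_of_socle pG); first exact: subgroupI sD (subgroup_height_ge _ _ _).
move=> x [[Dx mx] px]; apply: (finite_height_kernel finm sH hf injf).
by split=> //; apply: DH.
Qed.

End Sufficiency.

(** * Direct sums of cyclic groups *)

Section DirectSums.
Variables (V : zmodType) (K : Type) (m : K -> nat).
Hypothesis m_gt0 : forall k, (0 < m k)%N.
Implicit Types (A : set V) (c : K -> nat).

Lemma dsum_elem0 : dsum_elem m (fun=> 0%N).
Proof. by split=> //; exists nil. Qed.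

Lemma dsum_elem_sub c (d : K -> nat) : dsum_elem m c -> (forall k, d k < m k)%N ->
  (forall k, c k = 0 -> d k = 0)%N -> dsum_elem m d.
Proof. by move=> [_ [s cs]] dm cd; split=> //; exists s => k dk; apply: cs => /cd. Qed.

Section Morphism.
Variable Phi : (K -> nat) -> V.
Hypothesis PhiD : forall c d, dsum_elem m c -> dsum_elem m d ->
  Phi (dsum_add m c d) = Phi c + Phi d.

Lemma dsum_morph0 : Phi (fun=> 0%N) = 0.
Proof.
apply: (addrI (Phi (fun=> 0%N))); rewrite addr0 -PhiD; try exact: dsum_elem0.
by congr Phi; apply/funext => k; rewrite /dsum_add mod0n.
Qed.

Lemma dsum_elemMn c e : dsum_elem m c -> dsum_elem m (fun k => (e * c k) %% m k)%N.
Proof.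
by move=> mc; apply: (dsum_elem_sub mc) => k; [rewrite ltn_mod | move=> ->; rewrite muln0 mod0n].
Qed.

Lemma dsum_morphMn c e : dsum_elem m c -> Phi c *+ e = Phi (fun k => (e * c k) %% m k)%N.
Proof.
move=> mc; elim: e => [|e IHe].
  by rewrite mulr0n -dsum_morph0; congr Phi; apply/funext => k; rewrite mul0n mod0n.
rewrite mulrS IHe -PhiD //; last exact: dsum_elemMn.
by congr Phi; apply/funext => k; rewrite /dsum_add modnDmr mulSn.
Qed.

End Morphism.

Lemma iso_to_dsum_multiples A n : iso_to_dsum A m -> (forall k, m k %| n)%N ->
  multiples A n `<=` [set 0].
Proof.
move=> [Phi [_ [PhiD [_ PhiS]]]] mn _ [_ /PhiS[c [mc <-]] <-].
rewrite /= (dsum_morphMn PhiD) // -(dsum_morph0 PhiD); congr Phi.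
by apply/funext => k; apply/eqP/dvdn_mulr/mn.
Qed.

Lemma iso_to_dsum_torsion A d e : iso_to_dsum A m -> (forall k, e * d %| m k)%N ->
  torsion A e `<=` multiples A d.
Proof.
move=> [Phi [PhiA [PhiD [PhiI PhiS]]]] edm _ [/PhiS[c [mc <-]]].
rewrite (dsum_morphMn PhiD) // -(dsum_morph0 PhiD).
move=> /(PhiI _ _ (dsum_elemMn e mc) dsum_elem0) ec0.
have dc k : (d %| c k)%N.
  have /eqP mec : ((e * c k) %% m k = 0)%N by have := congr1 (@^~ k) ec0.
  have := dvdn_trans (edm k) mec; rewrite dvdn_pmul2l //.
  by have := m_gt0 k; have /dvdnP[i ->] := edm k; rewrite !muln_gt0 => /and3P[].
have mcd : dsum_elem m (fun k => c k %/ d)%N.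
  apply: (dsum_elem_sub mc) => k; last by move=> ->; rewrite div0n.
  by apply: leq_ltn_trans (leq_div _ _) _; apply: mc.1.
exists (Phi (fun k => c k %/ d)%N); first exact: PhiA.
rewrite (dsum_morphMn PhiD) //; congr Phi; apply/funext => k.
by rewrite mulnC divnK // modn_small //; apply: mc.1.
Qed.

End DirectSums.

Section Basis.
Variables (V : zmodType) (K : choiceType) (m : K -> nat) (v : K -> V).
Hypothesis m_gt0 : forall k, (0 < m k)%N.
Hypothesis vm : forall k, v k *+ m k = 0.
Implicit Types (c d : K -> nat) (q : {malg K}).

Definition malg_of c : {malg K} := xget 0 [set q : {malg K} | forall k, q@_k = (c k)%:Z].

Lemma malg_ofE c : dsum_elem m c -> forall k, (malg_of c)@_k = (c k)%:Z.
Proof.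
move=> [_ [s cs]]; apply: (@xgetPex _ 0 [set q : {malg K} | forall k, q@_k = (c k)%:Z]).
exists [malg k in [fset k in s]%fset => (c k)%:Z] => k; rewrite mcoeffE inE /=.
case: ifPn => // /negP ks; apply/esym/eqP; rewrite eqz_nat; apply/eqP; apply: contrapT => ck.
apply: ks; move: (cs k ck); elim: s {cs} => //= j s IHs [->|/IHs ks].
  by rewrite mem_head.
by rewrite inE ks orbT.
Qed.

Lemma dsum_elem_malg c q : (forall k, c k < m k)%N -> (forall k, q@_k = 0 -> c k = 0%N) ->
  dsum_elem m c.
Proof.
move=> cm qc; split=> //; exists (msupp q) => k ck.
have : k \in (msupp q : seq K).
  by change (k \in msupp q); rewrite -mcoeff_neq0; apply/eqP => /qc.
elim: (msupp q : seq K) => //= j s IHs; rewrite inE => /predU1P[->|/IHs]; first by left.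
by right.
Qed.

Lemma dsum_elem_add c d : dsum_elem m c -> dsum_elem m d -> dsum_elem m (dsum_add m c d).
Proof.
move=> mc md; apply: (@dsum_elem_malg _ (malg_of c + malg_of d)) => k.
  by rewrite ltn_mod.
rewrite mcoeffD !malg_ofE // -PoszD => -[/eqP].
by rewrite addn_eq0 => /andP[/eqP c0 /eqP d0]; rewrite /dsum_add c0 d0 mod0n.
Qed.

Lemma lincomb_malg_ofD c d : dsum_elem m c -> dsum_elem m d ->
  lincomb v (malg_of (dsum_add m c d)) = lincomb v (malg_of c) + lincomb v (malg_of d).
Proof.
move=> mc md; rewrite -raddfD; apply: eq_lincomb => k /=.
rewrite mcoeffD !malg_ofE //; last exact: dsum_elem_add.
rewrite -PoszD -!pmulrn /dsum_add [in RHS](divn_eq (c k + d k) (m k)).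
by rewrite mulrnDr mulnC mulrnA vm mul0rn add0r.
Qed.

Hypothesis indv : independent [set 0] v m.

Lemma lincomb_malg_of_inj c d : dsum_elem m c -> dsum_elem m d ->
  lincomb v (malg_of c) = lincomb v (malg_of d) -> c = d.
Proof.
move=> mc md /eqP; rewrite -subr_eq0 -raddfB => /eqP /indv cd; apply/funext => k.
have := cd k; rewrite mcoeffB !malg_ofE // -eqz_mod_dvd => /eqP.
by rewrite !modz_nat !modn_small ?mc.1 ?md.1 // => -[].
Qed.

Lemma iso_to_dsum_zspan : iso_to_dsum (zspan v setT) m.
Proof.
exists (fun c => lincomb v (malg_of c)); split.
  by move=> c _; exists (malg_of c) => //; apply: supportedT.
split; first exact: lincomb_malg_ofD.
split; first exact: lincomb_malg_of_inj.
move=> _ [q _ <-]; pose c k := `|(q@_k %% m k)%Z|%N.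
have m_neq0 k : (m k)%:Z != 0 by rewrite eqz_nat -lt0n.
have cE k : (c k)%:Z = (q@_k %% m k)%Z by rewrite /c gez0_abs ?modz_ge0.
have mc : dsum_elem m c.
  apply: (@dsum_elem_malg _ q) => k; last by rewrite /c => ->; rewrite mod0z.
  by rewrite -ltz_nat cE ltz_pmod // ltz_nat.
exists c; split=> //; apply: eq_lincomb => k; rewrite malg_ofE // cE.
by rewrite [in RHS](divz_eq q@_k (m k)) [RHS]mulrzDr [_ * Posz _]mulrC mulrz_natM vm mul0rz add0r.
Qed.

End Basis.

(** * Bounded groups with two consecutive exponents *)

Section TwoOrders.
Variables (p : nat) (V : zmodType).
Hypothesis p_pr : prime p.
Implicit Types (A S : set V).

Lemma nakayama A S N : subgroup S -> A `<=` sumset S (multiples A p) ->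
  multiples A (p ^ N) `<=` S -> A `<=` S.
Proof.
move=> sS AS AN x Ax.
suff [s Ss [y /AN Sy <-]] : sumset S (multiples A (p ^ N)) x by apply: subgroupD.
elim: N {AN} => [|k [s Ss [_ [y Ay <-] <-]]].
  by exists 0; [apply: subgroup0 | exists x; rewrite ?add0r //; exists x].
have [t St [_ [z Az <-] yE]] := AS y Ay.
exists (s + t *+ p ^ k); first by apply: subgroupD => //; apply: subgroupMn.
by exists (z *+ p ^ k.+1); [exists z | rewrite -yE mulrnDl mulrn_expS addrA].
Qed.

Lemma two_orders_generators A (XI XJ : set V) S m :
  subgroup A -> torsion A p `<=` multiples A (p ^ m) ->
  multiples A (p ^ m.+2) `<=` [set 0] ->
  (forall x, A x -> zspan (fun y => y *+ p ^ m.+1) XJ (x *+ p ^ m.+1)) ->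
  (forall x, torsion A (p ^ m.+1) x ->
    sumset (multiples A (p ^ m.+1)) (zspan (fun y => y *+ p ^ m) XI) (x *+ p ^ m)) ->
  subgroup S -> S `<=` A -> XI `<=` S -> XJ `<=` S -> A `<=` S.
Proof.
move=> sA socA Am genJ genI sS SA IS JS.
have spanS X k : X `<=` S -> zspan (fun y => y *+ p ^ k) X `<=` multiples S (p ^ k).
  move=> XS; apply: zspan_sub; first exact: subgroup_multiples.
  by move=> y /XS Sy; exists y.
apply: (@nakayama _ _ m.+2) => // [x Ax|x /Am ->]; last exact: subgroup0.
have [d Sd dE] := spanS _ _ JS _ (genJ x Ax).
have [|_ [u Au <-] [_ /(spanS _ _ IS)[s Ss <-] suE]] := genI (x - d).
  by split; [apply: subgroupB => //; apply: SA | rewrite mulrnBl dE subrr].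
have Ad := SA d Sd; have As := SA s Ss.
have [|w Aw wE] := @torsionX_multiples p V A m m sA socA (leqnSn m) (x - d - s - u *+ p).
  split; first by do !apply: subgroupB => //; apply: subgroupMn.
  by rewrite 2!mulrnBl -suE mulrn_expS addrK subrr.
rewrite subSnn expn1 in wE; exists (d + s); first exact: subgroupD.
exists (u *+ p + w *+ p); first by exists (u + w); rewrite ?mulrnDl //; apply: subgroupD.
by rewrite wE [u *+ p + _]addrC subrK -[x - d - s]addrA -opprD [LHS]addrC subrK.
Qed.

Lemma two_orders_decomposition A m : subgroup A -> torsion A p `<=` multiples A (p ^ m) ->
  multiples A (p ^ m.+2) `<=` [set 0] ->
  exists I J : Type, iso_to_dsum A (@two_orders p m.+1 I J).
Proof.
move=> sA socA Am; have s0 := subgroup_set0 V.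
have sAm := subgroup_multiples (p ^ m.+1) sA.
have [|XJ [XJA indJ genJ]] :=
    exists_maximal_independent p_pr s0 (A := A) (v := fun x => x *+ p ^ m.+1).
  by move=> x Ax; apply: Am; exists x; rewrite ?mulrn_expSr.
have [|XI [XIA indI genI]] :=
    exists_maximal_independent p_pr sAm (A := torsion A (p ^ m.+1)) (v := fun x => x *+ p ^ m).
  by move=> x [_ xm]; rewrite mulrn_expSr xm; apply: subgroup0.
pose I := {x : V | `[< XI x >]}; pose J := {x : V | `[< XJ x >]}.
have XIv (i : I) : XI (val i) by apply/asboolP/(valP i).
have XJv (j : J) : XJ (val j) by apply/asboolP/(valP j).
pose v (k : I + J) := match k with inl i => val i | inr j => val j end.
pose b (k : I + J) := if k is inl _ then m else m.+1.
have Av k : A (v k) by case: k => [i|j]; [exact: (XIA _ (XIv i)).1 | exact: XJA (XJv j)].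
have vb k : v k *+ p ^ (b k).+1 = 0.
  case: k => [i|j]; first exact: (XIA _ (XIv i)).2.
  by apply: Am; exists (val j) => //; apply: (Av (inr j)).
have AE : A = zspan v setT.
  have sS := subgroup_zspan v setT; have Sv k : zspan v setT (v k) by apply: mem_zspan.
  have SA : zspan v setT `<=` A by apply: zspan_sub => // k _; apply: Av.
  apply/seteqP; split=> //; apply: (two_orders_generators (XJ := XJ) sA socA Am _ genI sS SA).
  - by move=> x /genJ[_ -> [y Jy <-]]; rewrite add0r.
  - by move=> x Ix; apply: (Sv (inl (exist _ x (asboolT Ix)))).
  - by move=> x Jx; apply: (Sv (inr (exist _ x (asboolT Jx)))).
exists I, J; rewrite AE.
have -> : @two_orders p m.+1 I J = (fun k => p ^ (b k).+1)%N by apply/funext => -[].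
apply: iso_to_dsum_zspan => //; first by move=> k; rewrite expn_gt0 prime_gt0.
apply: independent_of_socle => //.
apply: (independent_sum_type (T := multiples A (p ^ m.+1))) => //.
- exact: independent_on_comp val_inj XIv indI.
- exact: independent_on_comp val_inj XJv indJ.
- by move=> i; rewrite mulrn_expSr; apply: (vb (inl i)).
- by move=> j; exists (val j) => //; apply: (Av (inr j)).
Qed.

End TwoOrders.

Section ConditionThree.
Variables (p : nat) (G : zmodType).
Hypotheses (p_pr : prime p) (pG : p_group G p).
Implicit Types (C D : set G).

Lemma condition3_sgb : condition3 G p -> semi_generalized_bassian G.
Proof.
move=> [[[]//|m] [_ [G' [F [I [J [[sG' [sF [dis gen]]] [isoG' [/finite_setE finF socF]]]]]]]]].
have m_gt0 (k : I + J) : (0 < two_orders p m.+1 k)%N by case: k => k; rewrite expn_gt0 prime_gt0.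
have G'm : multiples G' (p ^ m.+2) `<=` [set 0].
  by apply: iso_to_dsum_multiples isoG' _ => // -[] k; rewrite dvdn_Pexp2l ?prime_gt1.
have socG' : torsion G' p `<=` multiples G' (p ^ m).
  by apply: iso_to_dsum_torsion isoG' _ => // -[] k; rewrite -expnS dvdn_Pexp2l ?prime_gt1.
apply: (@finite_height_sgb p G p_pr pG m).
  move=> x [_ px]; have [a [b [Ga [Fb xE]]]] := gen x.
  have ab : a *+ p + b *+ p = 0 by rewrite -mulrnDl -xE.
  have pa : a *+ p = 0.
    apply: dis; first exact: subgroupMn.
    by rewrite -(opprK (a *+ p)) (addr0_eq ab); apply: (subgroupN sF); apply: subgroupMn.
  have pb : b *+ p = 0 by rewrite -ab pa add0r.
  have [y _ aE] := socG' a (conj Ga pa); have [u bE] := socF b Fb pb.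
  rewrite xE -aE bE; apply: (subgroupD (subgroup_height_ge p G m)); first exact: height_ge_mulrn.
  by apply: (@height_geW _ _ _ m.+2); [lia | apply: height_ge_mulrn].
apply: sub_finite_set finF => _ [x _ <-]; have [a [b [Ga [Fb ->]]]] := gen x.
rewrite mulrnDl (_ : a *+ _ = 0) ?add0r; first exact: subgroupMn.
by apply: G'm; exists a.
Qed.

(* [D] is maximal among the subgroups meeting [p^(m+2) G] trivially. *)
Lemma exists_bounded_summand m : torsion [set: G] p `<=` height_ge p m ->
  exists D C, [/\ int_direct_sum D C, multiples D (p ^ m.+2) `<=` [set 0],
    torsion D p `<=` multiples D (p ^ m) & torsion C p `<=` height_ge p m.+2].
Proof.
move=> socm; have sm := subgroup_height_ge p G m.+2.
pose Q := [set: G] `&` [set x | x *+ p = 0 -> height_ge p m.+2 x -> x = 0].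
have [|D _ maxD] := @exists_maximal_in _ Q _ (subgroup_set0 G); first by move=> _ ->.
have neatD := maximal_in_neat p_pr (subgroupT G) maxD; have [sD DQ DQmax] := maxD.
have Dm : D `&` height_ge p m.+2 `<=` [set 0].
  apply: (trivial_of_socle pG (subgroupI sD sm)) => x [[/DQ[_ Qx] mx] px].
  exact: Qx.
have [C DC mC] := neat_bounded_summand p_pr pG socm sD neatD Dm.
have purD := neat_pure socm sD neatD Dm; have [_ [sC [dis _]]] := DC.
exists D, C; split=> //.
- move=> _ [d Dd <-]; apply: Dm; split; last exact: height_ge_mulrn.
  exact: subgroupMn.
- by move=> d [Dd pd]; apply: purD; split=> //; apply: socm.
move=> t [Ct pt]; apply: contrapT => nt; apply: (nt); rewrite (dis t) //; first exact: subgroup0.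
apply: DQmax => _ [d Dd [a _ <-]]; split=> // _ mda.
have d0 : d = 0.
  apply: dis; rewrite // -(addrK (t *~ a) d).
  by apply: subgroupB (subgroupMz _ sC Ct) => //; apply: mC.
move: mda; rewrite d0 add0r => ta.
apply: (mulrz_eq0_dvdz _ pt); apply: (prime_dvdz_of_notin p_pr sm _ nt ta).
by rewrite pt; apply: subgroup0.
Qed.

Lemma bounded_condition3 m N : torsion [set: G] p `<=` height_ge p m ->
  (height_ge p N : set G) `<=` [set 0] -> finite_set (torsion (height_ge p m.+2 : set G) p) ->
  condition3 G p.
Proof.
move=> socm GN fin; have [D [C [DC Dm socD socC]]] := exists_bounded_summand socm.
have [sD [sC _]] := DC; have [I [J isoD]] := two_orders_decomposition p_pr sD socD Dm.
exists m.+1; split=> //; exists D, C, I, J; split=> //; split=> //; split.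
  apply/finite_setE; have finC : finite_set (torsion C p).
    by apply: sub_finite_set fin => x [Cx px]; split=> //; apply: socC.
  apply: sub_finite_set (finite_torsionX N sC finC) => x Cx; split=> //.
  by apply: GN; apply: height_ge_mulrn.
by move=> y Cy py; have [//|x _ <-] := socC y; exists x.
Qed.

End ConditionThree.

(** * Subgroups that are not essential in a summand *)

Section Necessity.
Variables (p : nat) (G : zmodType).
Hypotheses (p_pr : prime p) (pG : p_group G p).
Implicit Types (A D H M : set G) (x y : G) (T : set (G * G)).

Lemma pure_socle_low_height m D x y : subgroup D -> pure p D -> D (x + y *+ p) ->
  x *+ p ^ m.+1 = 0 -> ~ height_ge p m.+1 (x *+ p ^ m) ->
  exists2 t, torsion D p t & ~ height_ge p m.+1 t.
Proof.
move=> sD purD Dxy xm nxm.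
have [|c Dc cE] := purD m.+2 (y *+ p ^ m.+2).
  split; last exact: height_ge_mulrn.
  by rewrite -mulrn_expS -[_ *+ p ^ m.+1]add0r -xm -mulrnDl; apply: subgroupMn.
pose t := (x + y *+ p - c *+ p) *+ p ^ m.
have tE : t = x *+ p ^ m + (y - c) *+ p ^ m.+1.
  by rewrite /t -addrA -mulrnBl mulrnDl mulrn_expS.
exists t.
  split; first by apply: subgroupMn => //; apply: subgroupB => //; apply: subgroupMn.
  by rewrite tE mulrnDl !mulrn_expSr xm add0r mulrnBl cE subrr.
move=> ht; apply: nxm; rewrite -(addrK ((y - c) *+ p ^ m.+1) (x *+ _)) -tE.
exact: (subgroupB (subgroup_height_ge p G m.+1)) ht (height_ge_mulrn _ _ _).
Qed.

Lemma not_sgb_of_quotient m H x y : subgroup H -> embeds_in_quotient H ->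
  x *+ p ^ m.+1 = 0 -> ~ height_ge p m.+1 (x *+ p ^ m) -> H (x + y *+ p) ->
  torsion H p `<=` height_ge p m.+1 -> ~ semi_generalized_bassian G.
Proof.
move=> sH embH xm nxm Hxy Hm sgb; have [D [sD [sumD [HD essD]]]] := sgb H sH embH.
have [t Dt nt] := pure_socle_low_height sD (summand_pure sumD) (HD _ Hxy) xm nxm.
apply/nt/Hm; split; last by case: Dt.
exact: (essential_socle p_pr sD sH essD).
Qed.

(* With [g] extending [y - x] modulo [H] for [(x, y)] in [T], the embedding is [x + g x]; it is
   the identity modulo [M], so its kernel lies in [M]. *)
Lemma embeds_of_divisible_quotient H M T : subgroup H -> subgroup M -> H `<=` M ->
  M `<=` sumset H (multiples M p) -> hom_graph H M T -> (forall x y, T (x, y) -> M x) ->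
  (forall x y, T (x, y) -> H y -> x = 0) -> torsion M p `<=` domain T -> embeds_in_quotient H.
Proof.
move=> sH sM HM divM [sT TM T0] TM' TI Tdom.
pose T' : set (G * G) := [set (z.1, z.2 - z.1) | z in T].
have hT' : hom_graph H M T'.
  split=> [|_ _ [[x y] Txy [_ <-]]|_ [[x y] Txy [x0 <-]]]; last 2 first.
  - by apply: subgroupB => //; [apply: TM Txy | apply: TM' Txy].
  - by rewrite x0 subr0; apply: T0; rewrite -x0.
  split; first by exists 0; [apply: subgroup0 | rewrite /= subr0].
  move=> _ _ [z Tz <-] [w Tw <-]; exists (z - w); first exact: subgroupB.
  by rewrite pairB /= opprD addrACA -opprD.
have [E [[sE EM E0] TE Edom]] := extend_hom_divisible p_pr pG sH sM HM divM hT'.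
have [g gE] := choice Edom; exists (fun x => x + g x); split=> [x y|x y Hxy].
  have /E0 : E (0, g (x + y) - (g x + g y)).
    by rewrite -(subrr (x + y)); apply: (subgroupB sE (gE _) (subgroupD sE (gE x) (gE y))).
  by move=> Hg; rewrite [x + g x + _]addrACA opprD addrACA subrr add0r.
pose Ker z := exists2 w, E (z, w) & H (z + w).
suff Ker0 : Ker `<=` [set 0].
  apply/eqP; rewrite -subr_eq0; apply/eqP/Ker0; exists (g x - g y).
    by rewrite -pairB; apply: subgroupB.
  by rewrite addrACA -opprD.
apply: (trivial_of_socle pG) => [|z [[w Ezw Hzw] pz]].
  split=> [|z z' [w Ezw Hzw] [w' Ezw' Hzw']].
    by exists 0; [apply: (subgroup0 sE) | rewrite addr0; apply: subgroup0].
  by exists (w - w'); [apply: (subgroupB sE Ezw Ezw') | rewrite addrACA -opprD; apply: subgroupB].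
have Mz : M z.
  by rewrite -(addrK w z); apply: subgroupB; [|apply: HM|apply: EM Ezw].
have [t Tzt] := Tdom z (conj Mz pz); apply: (TI _ _ Tzt).
have : E (z, t - z) by apply: TE; exists (z, t).
move=> /(subgroupB sE Ezw); rewrite pairB subrr => /E0 Hw.
have -> : t = z + w - (w - (t - z)) by rewrite opprB -[t - z - w]addrA -opprD [RHS]addrC subrK.
exact: subgroupB.
Qed.

Lemma embeds_mod_socle A : subgroup A -> A `<=` multiples A p -> embeds_in_quotient (torsion A p).
Proof.
move=> sA divA; have sAp := subgroup_torsion p sA; have sA2 := subgroup_torsion (p ^ 2) sA.
apply: (@embeds_of_divisible_quotient _ A [set (w *+ p, w) | w in torsion A (p ^ 2)]) => //.
- by move=> x [].
- exact: subset_trans divA (sub_sumsetr sAp).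
- split=> [|_ _ [w [Aw _] [_ <-]] //|_ [w [Aw _] [w0 <-]] //]; split.
    by exists 0; rewrite ?mul0rn //; apply: subgroup0.
  move=> _ _ [v Av <-] [w Aw <-]; exists (v - w); first exact: subgroupB.
  by rewrite mulrnBl.
- by move=> _ _ [w [Aw _] [<- _]]; apply: subgroupMn.
- by move=> _ _ [w _ [<- <-]] [].
- move=> x [/divA[w Aw <-] pw]; exists w, w => //; split=> //.
  by rewrite -mulrn_expSr expn1.
Qed.

End Necessity.

(** * Infinite socles at all heights *)

Section PruferCoordinates.
Variable p : nat.
Hypothesis p_pr : prime p.
Implicit Types (k : nat * nat) (q : {malg (nat * nat)%type}).

(* Modulo the integers, [q |-> lincomb (prufer_coord j) q] is the [j]-th component of the
   homomorphism to a direct sum of quasicyclic groups [Z(p^oo)] sending the generator [(i, l)] to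
   [1 / p^(l+1)] in the [i]-th summand. *)
Definition prufer_coord (j : nat) k : rat := (k.1 == j)%:R / (p ^ k.2.+1)%:R.

Definition prufer_ker : set {malg (nat * nat)%type} :=
  [set q | forall j, lincomb (prufer_coord j) q \is a Num.int].

Lemma subgroup_int_num : subgroup [set x : rat | x \is a Num.int].
Proof. by split=> [|x y] /=; [apply: rpred0 | apply: rpredB]. Qed.

Lemma subgroup_prufer_ker : subgroup prufer_ker.
Proof.
split=> [j|q r Zq Zr j]; first by rewrite raddf0 rpred0.
by rewrite raddfB; apply: rpredB; [apply: Zq | apply: Zr].
Qed.

Lemma natX_neq0 n : (p ^ n)%:R != 0 :> rat.
Proof. by rewrite Num.Theory.pnatr_eq0 -lt0n expn_gt0 prime_gt0. Qed.

Lemma prufer_coord_int j k (a : int) : ((p ^ k.2.+1)%:Z %| a)%Z ->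
  prufer_coord j k *~ a \is a Num.int.
Proof.
move=> pa; rewrite (mulrz_dvdz _ pa) -mulr_natr divfK ?natX_neq0 //.
by rewrite rpredMz // rpred_nat.
Qed.

Lemma prufer_coord_dvdz k (a : int) : prufer_coord k.1 k *~ a \is a Num.int ->
  ((p ^ k.2.+1)%:Z %| a)%Z.
Proof.
rewrite /prufer_coord eqxx -mulrzl mul1r => /Num.Theory.intrP[b] /(canRL (mulfVK (natX_neq0 _))) E.
by apply/dvdzP; exists b; apply: (@intr_inj rat); rewrite E intrM.
Qed.

Lemma prufer_ker_coeff q k : prufer_ker q ->
  (forall l, l.1 = k.1 -> l <> k -> ((p ^ l.2.+1)%:Z %| q@_l)%Z) -> ((p ^ k.2.+1)%:Z %| q@_k)%Z.
Proof.
move=> Zq ql; apply: prufer_coord_dvdz; pose r := q - << q@_k *g k >>.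
have -> : prufer_coord k.1 k *~ q@_k = lincomb (prufer_coord k.1) q - lincomb (prufer_coord k.1) r.
  by rewrite -raddfB subKr /= lincombU.
apply: rpredB; first exact: Zq.
apply: (lincomb_subgroup subgroup_int_num) => l /=.
have [->|lk] := eqVneq l k; first by rewrite mcoeffB mcoeffUU subrr mulr0z rpred0.
rewrite mcoeffB mcoeffU eq_sym (negPf lk) subr0.
have [l1|l1] := eqVneq l.1 k.1; first by apply/prufer_coord_int/ql => //; apply/eqP.
by rewrite /prufer_coord (negPf l1) mul0r mul0rz rpred0.
Qed.

Definition prufer_shift k : nat * nat := (k.1, k.2.+1).

Lemma prufer_ker_shift q : prufer_ker (relabel prufer_shift q *+ p - q).
Proof.
move=> j; rewrite raddfB raddfMn /= lincomb_relabel lincombMn.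
suff -> : (fun k => (prufer_coord j \o prufer_shift) k *+ p) = prufer_coord j.
  by rewrite subrr rpred0.
apply/funext => k; rewrite /prufer_coord /= -[LHS]mulr_natr [X in X%:R^-1]expnSr natrM.
rewrite invfM mulrA mulfVK //.
exact: (natX_neq0 1).
Qed.

Definition prufer_base k : nat * nat := (choice.pickle k, 0%N).

Lemma prufer_base_inj : injective prufer_base.
Proof. by move=> k l [/(pcan_inj choice.pickleK)]. Qed.

Lemma prufer_ker_base q : prufer_ker (relabel prufer_base q) <-> forall k, (p%:Z %| q@_k)%Z.
Proof.
split=> [Zq k|pq j].
  rewrite -(mcoeff_relabel q k prufer_base_inj); apply: (prufer_ker_coeff Zq) => l l1 lk.
  rewrite mcoeff_relabel_eq0 ?dvdz0 // => k' lE; apply: lk.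
  by move: l1; rewrite -lE => /= /(pcan_inj choice.pickleK) ->.
rewrite lincomb_relabel; apply: (lincomb_subgroup subgroup_int_num) => k.
by apply: prufer_coord_int; rewrite expn1.
Qed.

End PruferCoordinates.

Section PruferQuotient.
Variables (p : nat) (G : zmodType) (Y : nat * nat -> G) (b : nat * nat -> nat).
Hypotheses (p_pr : prime p) (pG : p_group G p).
Hypothesis Yb : forall k, Y k *+ p ^ (b k).+1 = 0.
Hypothesis socY : independent [set 0] (fun k => Y k *+ p ^ b k) (fun=> p).
Hypothesis b_ge : forall k, (k.2 <= b k)%N.

Definition prufer_subgroup : set G := [set lincomb Y q | q in prufer_ker p].

Let M := zspan Y setT.
Let sM : subgroup M := subgroup_zspan Y setT.
Let indY : independent [set 0] Y (fun k => p ^ (b k).+1)%N := independent_of_socle p_pr Yb socY.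

Lemma subgroup_prufer_subgroup : subgroup prufer_subgroup.
Proof.
have sZ := subgroup_prufer_ker p; split.
  by exists 0; [apply: (subgroup0 sZ) | rewrite raddf0].
by move=> _ _ [q Zq <-] [r Zr <-]; exists (q - r); [apply: (subgroupB sZ) | rewrite raddfB].
Qed.

Lemma prufer_subgroup_ker q : prufer_subgroup (lincomb Y q) -> prufer_ker p q.
Proof.
move=> [r Zr rq]; have sZ := subgroup_prufer_ker p.
have qr : lincomb Y (q - r) = 0 by rewrite raddfB /= rq subrr.
rewrite -(subrK r q); apply: (subgroupD sZ) Zr => j.
apply: (lincomb_subgroup subgroup_int_num) => k; apply: prufer_coord_int => //.
by apply: dvdz_trans (indY qr k); rewrite dvdzE /= dvdn_exp2l // ltnS b_ge.
Qed.

Lemma prufer_subgroup_shift q : prufer_subgroup (lincomb Y (q - relabel prufer_shift q *+ p)).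
Proof.
exists (q - relabel prufer_shift q *+ p) => //; rewrite -opprB.
exact: (subgroupN (subgroup_prufer_ker p)) (prufer_ker_shift p_pr q).
Qed.

Lemma prufer_quotient_divisible : M `<=` sumset prufer_subgroup (multiples M p).
Proof.
move=> _ [q _ <-]; exists (lincomb Y (q - relabel prufer_shift q *+ p)).
  exact: prufer_subgroup_shift.
exists (lincomb Y (relabel prufer_shift q) *+ p); last by rewrite raddfB raddfMn subrK.
by exists (lincomb Y (relabel prufer_shift q)) => //; eexists; [apply: supportedT|].
Qed.

(* The socle of [zspan Y setT] is carried to the independent elements [1 / p] of the quasicyclic
   summands of the quotient. *)
Lemma embeds_in_prufer_quotient : embeds_in_quotient prufer_subgroup.
Proof.
pose s k := Y k *+ p ^ b k; pose Y0 := Y \o prufer_base.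
have s0 c : (forall k, (p%:Z %| c@_k)%Z) -> lincomb s c = 0.
  by move=> pc; apply: lincomb_eq0 => k; apply: mulrz_eq0_dvdz (pc k) _; rewrite mulrn_expSr.
have HY0 c : prufer_subgroup (lincomb Y0 c) -> forall k, (p%:Z %| c@_k)%Z.
  by rewrite -lincomb_relabel => /prufer_subgroup_ker /(prufer_ker_base p_pr).
apply: (@embeds_of_divisible_quotient p G p_pr pG prufer_subgroup M
  [set (lincomb s c, lincomb Y0 c) | c in setT] subgroup_prufer_subgroup sM).
- by move=> _ [q _ <-]; exists q => //; apply: supportedT.
- exact: prufer_quotient_divisible.
- split=> [|_ _ [c _ [_ <-]]|_ [c _ [/esym cs <-]]].
  + split; first by exists 0; rewrite ?raddf0.
    move=> _ _ [c _ <-] [d _ <-]; exists (c - d) => //.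
    by rewrite pairB !raddfB.
  + by rewrite -lincomb_relabel; eexists; [apply: supportedT|].
  + rewrite -lincomb_relabel; exists (relabel prufer_base c) => //.
    exact/(prufer_ker_base p_pr)/socY.
- move=> _ _ [c _ [<- _]]; apply: lincomb_subgroup => // k; apply: subgroupMz => //.
  by apply: subgroupMn => //; apply: mem_zspan.
- by move=> _ _ [c _ [<- <-]] /HY0 /s0.
- move=> _ [[q _ <-] /(independent_socle_dvd p_pr indY) /malg_divz[d dE]].
  by exists (lincomb Y0 d), d; rewrite // (lincomb_scale _ dE).
Qed.

Lemma prufer_subgroup_socle m : b (0%N, m) = m ->
  (forall k, k <> (0%N, m) -> (maxn m k.2).+1 <= b k)%N ->
  torsion prufer_subgroup p `<=` height_ge p m.+1.
Proof.
move=> b0 bm _ [[q Zq <-] /(independent_socle_dvd p_pr indY) pq].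
have sm := subgroup_height_ge p G m.+1.
have Ym : Y (0%N, m) *+ p ^ m.+1 = 0 by rewrite -(Yb (0%N, m)) b0.
apply: (lincomb_subgroup sm) => k; have [->|/eqP km] := eqVneq k (0%N, m).
  apply: (subgroupMz_dvdz (n := p ^ m.+1)) => //; last by rewrite Ym; apply: subgroup0.
  apply: (prufer_ker_coeff p_pr Zq) => l _ /bm bl.
  by apply: dvdz_trans (pq l); rewrite dvdzE /= dvdn_exp2l //; lia.
apply: (subgroupMz_dvdz sm (pq k)).
by apply: height_geW (height_ge_mulrn _ _ _); have := bm k km; lia.
Qed.

End PruferQuotient.

Section InfiniteSocles.
Variables (p : nat) (G : zmodType).
Hypotheses (p_pr : prime p) (pG : p_group G p).

Lemma exists_prufer_system m (x : G) : x *+ p ^ m.+1 = 0 -> x *+ p ^ m <> 0 ->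
  (forall k, infinite_set (torsion (height_ge p k : set G) p)) ->
  exists Y b, [/\ forall k, Y k *+ p ^ (b k).+1 = 0,
    independent [set 0] (fun k => Y k *+ p ^ b k) (fun=> p),
    Y (0%N, m) = x, b (0%N, m) = m &
    forall k, k <> (0%N, m) -> ((maxn m k.2).+1 <= b k)%N].
Proof.
move=> xm xm0 inf; pose h (k : nat * nat) := (maxn m k.2).+1; pose k0 := (0%N, m).
have s0 := subgroup_set0 G; have px : x *+ p ^ m *+ p = 0 by rewrite mulrn_expSr.
pose label i : nat * nat := odflt k0 (choice.unpickle i).
have [|||s [sS inds]] := @exists_independent_sequence G p p_pr (adjoin [set 0] (x *+ p ^ m))
    (fun i => torsion (height_ge p (h (label i))) p) (subgroup_adjoin _ s0).
- exact: finite_adjoin p_pr (finite_set1 0) px.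
- by move=> i z [].
- by move=> i; apply: inf.
have /choice[y yE] : forall k, exists y, y *+ p ^ h k = s (choice.pickle k).
  by move=> k; have [[y _ <-] _] := sS (choice.pickle k); exists y; rewrite /label choice.pickleK.
have ps k : s k *+ p = 0 by case: (sS k).
pose Y := [eta y with k0 |-> x]; pose b := [eta h with k0 |-> m].
have bE k : k != k0 -> b k = h k by rewrite /b /= => /negPf ->.
have YE k : k != k0 -> Y k = y k by rewrite /Y /= => /negPf ->.
have [bk0 Yk0] : b k0 = m /\ Y k0 = x by rewrite /b /Y /= eqxx.
have YbE : (fun k => Y k *+ p ^ b k) = [eta s \o choice.pickle with k0 |-> x *+ p ^ m].
  apply/funext => k; have [->|kk0] := eqVneq k k0; first by rewrite bk0 Yk0 /= eqxx.
  by rewrite bE // YE // yE /= (negPf kk0).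
exists Y, b; split=> // [k||k /eqP/bE->] //.
  have [->|kk0] := eqVneq k k0; first by rewrite bk0 Yk0.
  by rewrite bE // YE // -mulrn_expSr yE.
rewrite YbE; apply: (independent_update p_pr s0) => //; last by move=> k; apply: ps.
exact: independent_comp (pcan_inj choice.pickleK) inds.
Qed.

Lemma not_sgb_of_infinite_socles m (x : G) : x *+ p ^ m.+1 = 0 ->
  ~ height_ge p m.+1 (x *+ p ^ m) ->
  (forall k, infinite_set (torsion (height_ge p k : set G) p)) -> ~ semi_generalized_bassian G.
Proof.
move=> xm nxm inf; have [|Y [b [Yb socY Ym bm b_gt]]] := exists_prufer_system xm _ inf.
  by move=> x0; apply: nxm; rewrite x0; apply: subgroup0 (subgroup_height_ge _ _ _).
have b_ge k : (k.2 <= b k)%N.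
  have [->|/eqP/b_gt] := eqVneq k (0%N, m); first by rewrite bm.
  by rewrite gtn_max => /andP[_ /ltnW].
apply: (@not_sgb_of_quotient p G p_pr m (prufer_subgroup p Y) x (- Y (0%N, m.+1))) => //.
- exact: subgroup_prufer_subgroup.
- exact: (embeds_in_prufer_quotient p_pr pG Yb socY).
- have := prufer_subgroup_shift Y p_pr << (0%N, m) >>.
  by rewrite raddfB raddfMn /= lincomb_relabel !lincomb1 /= Ym mulNrn.
- exact: prufer_subgroup_socle.
Qed.

End InfiniteSocles.

(** * Shifting a homogeneous summand *)

Section Homogeneous.
Variables (p : nat) (G : zmodType) (n : nat) (y : nat -> G).
Hypotheses (p_pr : prime p) (pG : p_group G p).
Hypothesis yn : forall i, y i *+ p ^ n.+1 = 0.
Hypothesis socy : independent (height_ge p n.+1) (fun i => y i *+ p ^ n) (fun=> p).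
Implicit Types (q : {malg nat}) (L : set G) (f : nat -> nat).

Lemma homogeneous_height j q : (j <= n.+1)%N -> height_ge p j (lincomb y q) ->
  forall i, ((p ^ j)%:Z %| q@_i)%Z.
Proof.
elim: j => [|j IHj] jn hq i; first by rewrite expn0 dvd1z.
have [r rE] := malg_divz (IHj (ltnW jn) (height_geW (leqnSn j) hq)).
suff pr : forall i, (p%:Z %| r@_i)%Z by rewrite rE expnSr PoszM dvdz_mul.
apply: socy; have := height_geM (n - j) hq.
rewrite addSn subnKC // (lincomb_scale y rE) lincombMn.
by under eq_fun do rewrite mulrn_expD subnKC //.
Qed.

Lemma homogeneous_independent : independent [set 0] y (fun=> p ^ n.+1)%N.
Proof.
move=> q q0; apply: homogeneous_height => //; rewrite q0.
exact: subgroup0 (subgroup_height_ge _ _ _).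
Qed.

Lemma homogeneous_pure : pure p (zspan y setT).
Proof.
move=> j _ [[q _ <-] hq]; have [jn|nj] := leqP j n.+1.
  have [r rE] := malg_divz (homogeneous_height jn hq).
  exists (lincomb y r); first by exists r => //; apply: supportedT.
  by rewrite lincombMn -(lincomb_scale y rE).
have [r rE] := malg_divz (homogeneous_height (leqnn _) (height_geW (ltnW nj) hq)).
rewrite (lincomb_scale y rE) lincomb_eq0 => [|i]; last by rewrite yn mul0rz.
exact: subgroup0 (subgroup_multiples _ (subgroup_zspan _ _)).
Qed.

Lemma homogeneous_summand :
  exists2 L, int_direct_sum (zspan y setT) L & height_ge p n.+1 `<=` L.
Proof.
apply: (pure_bounded_summand p_pr pG); [exact: subgroup_zspan | exact: homogeneous_pure |].
by move=> _ [_ [q _ <-] <-]; rewrite lincombMn; apply: lincomb_eq0 => i; rewrite yn mul0rz.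
Qed.

Lemma lincomb_comp_eq0 f q : injective f -> lincomb (y \o f) q = 0 <-> lincomb y q = 0.
Proof.
move=> f_inj; have indyf := independent_comp f_inj homogeneous_independent.
have q0 (g : nat -> nat) : (forall i, ((p ^ n.+1)%:Z %| q@_i)%Z) -> lincomb (y \o g) q = 0.
  by move=> pq; apply: lincomb_eq0 => i; apply: mulrz_eq0_dvdz (pq i) _; apply: yn.
by split=> [/indyf /(q0 id)|/homogeneous_independent /(q0 f)].
Qed.

Lemma exists_induced_endo L f : int_direct_sum (zspan y setT) L -> injective f ->
  exists e : {additive G -> G}, forall q l, L l -> e (lincomb y q + l) = lincomb (y \o f) q + l.
Proof.
move=> [_ [sL [dis gen]]] f_inj.
have /choice[e eP] : forall x, exists z, exists q l,
    [/\ L l, x = lincomb y q + l & z = lincomb (y \o f) q + l].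
  by move=> x; have [_ [l [[q _ <-] [Ll ->]]]] := gen x; exists (lincomb (y \o f) q + l), q, l.
have eE q l : L l -> e (lincomb y q + l) = lincomb (y \o f) q + l.
  move=> Ll; have [r [m [Lm E ->]]] := eP (lincomb y q + l).
  have qrE : lincomb y (r - q) = l - m.
    by apply/eqP; rewrite raddfB /= subr_eq addrAC [l + _]addrC E addrK.
  have qr0 : lincomb y (r - q) = 0.
    apply: dis; first by exists (r - q) => //; apply: supportedT.
    by rewrite qrE; apply: subgroupB.
  have -> : m = l by apply/eqP; rewrite eq_sym -subr_eq0 -qrE qr0.
  by congr (_ + _); apply/eqP; rewrite -subr_eq0 -raddfB; apply/eqP/lincomb_comp_eq0.
have eB : zmod_morphism e.
  move=> u v; have [q [l [Ll -> ->]]] := eP u; have [r [m [Lm -> ->]]] := eP v.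
  rewrite opprD addrACA -raddfB eE; last exact: subgroupB.
  by rewrite raddfB opprD addrACA.
pose eM := GRing.isZmodMorphism.Build G G e eB.
by exists (HB.pack e eM : {additive G -> G}).
Qed.

End Homogeneous.

(* An endomorphism shifting a homogeneous summand with basis [y0], [y1], ... by one place and
   fixing a complement of it. *)
Record shift_endo (p : nat) (G : zmodType) n (y0 : G) (e : {additive G -> G}) : Prop := ShiftEndo {
  shift_base_exp : y0 *+ p ^ n.+1 = 0;
  shift_base_height : ~ height_ge p n.+1 (y0 *+ p ^ n);
  shift_inj : forall x, e x = 0 -> x = 0;
  shift_id : forall x, height_ge p n.+1 x -> e x = x;
  shift_avoid : forall x (a : int), e x = y0 *~ a -> y0 *~ a = 0 }.

Section Shift.
Variables (p : nat) (G : zmodType).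
Hypotheses (p_pr : prime p) (pG : p_group G p).

Lemma exists_homogeneous_system n : infinite_set (torsion (height_ge p n : set G) p) ->
  finite_set (torsion (height_ge p n.+1 : set G) p) ->
  exists y : nat -> G, (forall i, y i *+ p ^ n.+1 = 0) /\
    independent (height_ge p n.+1) (fun i => y i *+ p ^ n) (fun=> p).
Proof.
move=> inf fin; have sn := subgroup_height_ge p G n.+1.
have [||s [sS inds]] := @exists_independent_sequence G p p_pr _ (fun=> torsion (height_ge p n) p)
    (subgroup_torsion p sn) fin; [by move=> _ x [] | by [] |].
have /choice[y yE] : forall i, exists y, y *+ p ^ n = s i.
  by move=> i; have [[y _ <-] _] := sS i; exists y.
have ps i : s i *+ p = 0 by case: (sS i).
exists y; split=> [i|q hq]; first by rewrite -mulrn_expSr yE.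
have yEs : (fun i => y i *+ p ^ n) = s by apply/funext.
rewrite yEs in hq; apply: inds; split=> //.
by rewrite lincombMn; apply: lincomb_eq0 => i; rewrite ps mul0rz.
Qed.

Lemma exists_shift_endo n : infinite_set (torsion (height_ge p n : set G) p) ->
  finite_set (torsion (height_ge p n.+1 : set G) p) ->
  exists (y0 : G) (e : {additive G -> G}), shift_endo p n y0 e.
Proof.
move=> inf fin; have [y [yn socy]] := exists_homogeneous_system inf fin.
have [L yL nL] := homogeneous_summand p_pr pG yn socy.
have [e eE] := exists_induced_endo yn socy yL succn_inj.
have [_ [sL [dis gen]]] := yL; have indy := homogeneous_independent socy.
have sep q l : L l -> lincomb y q + l = 0 -> lincomb y q = 0 /\ l = 0.
  move=> Ll ql; have q0 : lincomb y q = 0.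
    apply: dis; first by exists q => //; apply: supportedT.
    by rewrite -[lincomb y q]opprK (addr0_eq ql); apply: subgroupN.
  by split; rewrite // -ql q0 add0r.
have shq q : lincomb (y \o succn) q = lincomb y (relabel succn q) by rewrite lincomb_relabel.
exists (y 0%N), e; split=> //.
- move=> h0; have := socy << 0%N >>; rewrite lincomb1 => /(_ h0 0%N); rewrite mcoeffUU.
  by rewrite dvdzE /= dvdn1 => /eqP p1; have := p_pr; rewrite p1.
- move=> x; have [_ [l [[q _ <-] [Ll ->]]]] := gen x.
  rewrite eE // shq => /(sep _ _ Ll)[]; rewrite -shq.
  by move=> /(lincomb_comp_eq0 yn socy _ succn_inj)-> ->; rewrite addr0.
- by move=> x /nL Lx; have := eE 0 x Lx; rewrite !raddf0 !add0r.
- move=> x a; have [_ [l [[q _ <-] [Ll ->]]]] := gen x; rewrite eE // shq.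
  move=> /eqP; rewrite -subr_eq0 addrAC -lincombU -raddfB => /eqP /(sep _ _ Ll)[/indy /(_ 0%N) + _].
  rewrite mcoeffB mcoeff_relabel_eq0 // mcoeffUU sub0r dvdzE abszN -dvdzE lincombU.
  by move=> na; apply: mulrz_eq0_dvdz na (yn 0%N).
Qed.

Variables (n : nat) (y0 : G) (e : {additive G -> G}).
Hypothesis she : shift_endo p n y0 e.

Lemma shift_base_neq0 : y0 *+ p ^ n <> 0.
Proof.
move=> y0n; apply: (shift_base_height she); rewrite y0n.
exact: subgroup0 (subgroup_height_ge _ _ _).
Qed.

Lemma not_sgb_of_high_shift m (x : G) : x *+ p ^ m.+1 = 0 -> ~ height_ge p m.+1 (x *+ p ^ m) ->
  (m.+2 <= n)%N -> ~ semi_generalized_bassian G.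
Proof.
move=> xm nxm mn; pose z := x + y0 *+ p; have y0n := shift_base_exp she.
have nE : n = n.-1.+1 by rewrite prednK //; lia.
have xl l : (m < l)%N -> x *+ p ^ l = 0.
  by move=> /subnKC <-; rewrite -mulrn_expD xm mul0rn.
have zn : z *+ p ^ n.-1.+1 = 0 by rewrite -nE mulrnDl mulrn_expS y0n xl ?addr0 //; lia.
have zn1 : z *+ p ^ n.-1 = y0 *+ p ^ n.
  by rewrite mulrnDl mulrn_expS -nE xl ?add0r //; lia.
have s0 := subgroup_set0 G; pose H := adjoin [set 0] z.
have sH : subgroup H by apply: subgroup_adjoin.
have socH : torsion H p `<=` adjoin [set 0] (y0 *+ p ^ n).
  by rewrite -zn1; apply: torsion_cyclic; rewrite // zn1; apply: shift_base_neq0.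
apply: (@not_sgb_of_quotient p G p_pr m H x y0 sH _ xm nxm).
- apply: (embeds_in_quotient_comp (E := [set 0]) (e := e)) (embeds_in_quotient0 G) => u.
  split=> [Hu|->]; last by rewrite raddf0; apply: subgroup0.
  have sK : subgroup [set v | H (e v)].
    split=> [|v w Hv Hw] /=; first by rewrite raddf0; apply: subgroup0.
    by rewrite raddfB; apply: subgroupB.
  apply: (trivial_of_socle pG sK) Hu => v [Hv pv].
  have [|_ -> [a _]] := socH (e v); first by split; rewrite // -raddfMn pv raddf0.
  rewrite add0r -mulrz_natM => ev; apply: (shift_inj she).
  by rewrite -ev; apply: (shift_avoid she (esym ev)).
- exact: mem_adjoin.
- move=> h /socH[_ -> [a _ <-]]; rewrite add0r; apply: subgroupMz; first exact: subgroup_height_ge.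
  by apply: (@height_geW _ _ _ n); [lia | apply: height_ge_mulrn].
Qed.

Section DivisiblePart.
Variables (N : nat) (w : G).
Hypotheses (nN : (n < N)%N) (Aw : height_ge p N w).
Hypotheses (wn : w *+ p ^ n.+1 <> 0) (wn1 : w *+ p ^ n.+2 = 0).

Let A : set G := height_ge p N.
Let H := adjoin (torsion A p) (y0 + w).
Let sA : subgroup A := subgroup_height_ge p G N.

Let fixA v : A v -> e v = v. Proof. by move=> Av; apply: (shift_id she); apply: height_geW Av. Qed.

Lemma shift_preimage_adjoin x : H (e x) <-> torsion A p x.
Proof.
split=> [[t [At pt] [a _ xE]]|Ax]; last by rewrite fixA; [apply: sub_adjoin | case: Ax].
have Atwa : A (t + w *~ a) by apply: subgroupD => //; apply: subgroupMz.
have ea : e (x - (t + w *~ a)) = y0 *~ a.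
  by rewrite raddfB /= (fixA Atwa) -xE mulrzDl addrCA addrK.
have y0a := shift_avoid she ea.
have xE' : x = t + w *~ a.
  by apply/eqP; rewrite -subr_eq0; apply/eqP/(shift_inj she); rewrite ea.
have na : ((p ^ n.+1)%:Z %| a)%Z.
  apply: (primeX_dvdz_of_notin p_pr (subgroup_set0 G)) y0a; first exact: (shift_base_exp she).
  exact: shift_base_neq0.
rewrite xE'; split=> //.
rewrite mulrnDl pt add0r mulrzMnC; apply: mulrz_eq0_dvdz na _.
by rewrite mulrn_expS.
Qed.

Lemma socle_adjoin_height : torsion H p `<=` height_ge p n.+1.
Proof.
move=> _ [[t [At pt] [a _ <-]]]; rewrite mulrnDl pt add0r mulrzMnC -mulrz_natM mulrzDl => pa0.
have Awa : A (w *~ (p%:Z * a)) by apply: subgroupMz.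
have wE : y0 *~ (p%:Z * a) = - (w *~ (p%:Z * a)) by rewrite -(addr0_eq pa0) opprK.
have y0a : y0 *~ (p%:Z * a) = 0.
  apply: (shift_avoid she (x := - (w *~ (p%:Z * a)))).
  by rewrite wE fixA //; apply: subgroupN.
have : ((p ^ n.+2)%:Z %| p%:Z * a)%Z.
  apply: (primeX_dvdz_of_notin p_pr (subgroup_set0 G) wn1 wn).
  by rewrite /= -[w *~ _]opprK -wE y0a oppr0.
rewrite expnS PoszM dvdz_mul2l ?eqz_nat -?lt0n ?prime_gt0 // => na.
rewrite mulrzDl (mulrz_eq0_dvdz na (shift_base_exp she)) add0r.
by apply: (height_geW nN); apply: subgroupD => //; apply: subgroupMz.
Qed.

End DivisiblePart.

Lemma not_sgb_of_divisible_height N (u : G) : (n < N)%N ->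
  (height_ge p N : set G) `<=` multiples (height_ge p N) p -> height_ge p N u -> u <> 0 ->
  ~ semi_generalized_bassian G.
Proof.
move=> nN divN Nu u0; have sN := subgroup_height_ge p G N.
have [i [ni pi]] := exists_socle_multiple pG u0.
have [v Nv vE] := p_divisibleX n.+2 divN (subgroupMn (p ^ i) sN Nu).
have Aw : height_ge p N (v *+ p) by apply: subgroupMn.
have wn : v *+ p *+ p ^ n.+1 = u *+ p ^ i by rewrite mulrn_expS vE.
have wn0 : v *+ p *+ p ^ n.+1 <> 0 by rewrite wn.
have wn1 : v *+ p *+ p ^ n.+2 = 0 by rewrite -mulrn_expSr wn.
apply: (@not_sgb_of_quotient p G p_pr n (adjoin (torsion (height_ge p N) p) (y0 + v *+ p))
  y0 v _ _ (shift_base_exp she) (shift_base_height she)).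
- exact/subgroup_adjoin/subgroup_torsion.
- exact: embeds_in_quotient_comp (shift_preimage_adjoin nN Aw wn1)
    (embeds_mod_socle p_pr pG sN divN).
- exact/mem_adjoin/subgroup_torsion.
- exact: socle_adjoin_height.
Qed.

End Shift.

Lemma sgb_necessary (p : nat) (G : zmodType) : prime p -> p_group G p ->
  semi_generalized_bassian G -> divisible G \/ finite_p_rank G p \/ condition3 G p.
Proof.
move=> p_pr pG sgb; have [?|ndiv] := pselect (divisible G); first by left.
right; have [?|ninf] := pselect (finite_p_rank G p); [by left | right].
have [m [x [xm nxm socm]]] := exists_minimal_order_element p_pr pG ndiv.
pose fin k := finite_set (torsion (height_ge p k : set G) p).
have [N finN] : exists N, fin N.
  by apply/not_existsP => inf; apply: (not_sgb_of_infinite_socles p_pr pG xm nxm inf sgb).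
have [||n [infn /contrapT finn]] := @nat_switch (fun k => ~ fin k) N; [|by []|].
  move=> fin0; apply/ninf/finite_setE; apply: sub_finite_set fin0 => z pz.
  by split=> //; apply: height_ge0.
have [y0 [e she]] := exists_shift_endo p_pr pG infn finn.
have nm : (n <= m.+1)%N.
  rewrite leqNgt; apply/negP => mn.
  exact: (not_sgb_of_high_shift p_pr pG she xm nxm mn sgb).
have finm : fin m.+2.
  by apply: sub_finite_set finn => z [hz pz]; split=> //; apply: height_geW hz.
have [k mk divk] := finite_socle_divisible pG finm.
apply: (bounded_condition3 p_pr pG (N := k) socm) => // u ku; apply: contrapT => u0.
exact: (not_sgb_of_divisible_height p_pr pG she (leq_ltn_trans nm mk) divk ku u0 sgb).
Qed.

Theorem theorem2p11 (p : nat) (G : zmodType) :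
  prime p -> p_group G p ->
  (semi_generalized_bassian G <->
     divisible G \/ finite_p_rank G p \/ condition3 G p).
Proof.
move=> p_pr pG; split; first exact: sgb_necessary p_pr pG.
case=> [divG|[finG|cond3G]].
- exact: divisible_sgb p_pr pG divG.
- exact: finite_rank_sgb p_pr pG finG.
- exact: condition3_sgb p_pr pG cond3G.
Qed.
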